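(* Let $(X,m)$ be a $\sigma$-finite measure space, let $T$ be a Ritt operator on $L^1(X,m)$, and let $r>0$ and $s\ge 1$ be real numbers. Then: (1) For every real $\alpha>-1$ with $sr>\alpha+1$, the map $f\mapsto Q^T_{\alpha,s,r}f=\Big(\sum_{n=1}^{\infty} n^{\alpha}|T^n(I-T)^r f|^{s}\Big)^{1/s}$ is bounded in $L^1$. (2) For every real $\alpha<r$, the map $f\mapsto \sup_{n\ge 1} n^{\alpha}|T^n(I-T)^{r}f|$ is bounded in $L^1$. (3) If $\beta=0$, or if $\beta>0$ and $s(r-\beta)>1$, then both $f\mapsto \lVert n^{\beta}T^n(I-T)^r f\rVert_{v(s)}$ and $f\mapsto\lVert n^{\beta}T^n(I-T)^r f\rVert_{o(s)}$ (the latter for any increasing sequence of positive integers defining $o(s)$) are bounded in $L^1$. (4) Let $\{n_k\}$ be any increasing sequence of positive integers such that $n_{k+1}-n_k\sim n_k^{\alpha}$ for some $\alpha\in(0,1)$, and let $0\le\beta<1-\alpha$. Then (a) $f\mapsto\Big(\sum_k n_k^{\beta s}|T^{n_k}f-T^{n_{k+1}}f|^s\Big)^{1/s}$ and $f\mapsto\Big(\sum_k n_k^{\beta s}\max_{n_k\le n<n_{k+1}}|T^nf-T^{n_k}f|^s\Big)^{1/s}$ are bounded in $L^1$ for $s>(1-\alpha)/(1-\alpha-\beta)$; and (b) $f\mapsto\Big(\sum_k n_k^{\beta s}\lVert\{T^nf:n_k\le n<n_{k+1}\}\rVert_{v(s)}^s\Big)^{1/s}$ is bounded in $L^1$ fo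r $s>1/(1-\alpha-\beta)$.
   Context: A bounded linear operator $T$ on a Banach space is a Ritt operator if it is power bounded ($\sup_{n\ge 0}\lVert T^n\rVert<\infty$) and $\sup_n n\lVert T^n-T^{n+1}\rVert<\infty$. Fractional powers: for $0<\theta<1$ and $k\ge1$ put $g(\theta,k)=\frac{\theta|\theta-1|\cdots|\theta-k+1|}{k!}\ge 0$, so that $(1-x)^\theta=1-\sum_{k\ge1}g(\theta,k)x^k$ for $|x|\le1$ and $\sum_k g(\theta,k)=1$. For $T$ power bounded, $(I-T)^\theta=I-\sum_{k\ge1}g(\theta,k)T^k$. For real $r>0$, $(I-T)^r=(I-T)^{\lfloor r\rfloor}(I-T)^{r-\lfloor r\rfloor}$ (with $(I-T)^0=I$). Absolute values, powers, sums, suprema and maxima of functions in $L^1(X,m)$ are taken pointwise a.e. A map $f\mapsto Vf$ assigning to $f\in L^1(X,m)$ a nonnegative measurable function is ''bounded in $L^1$'' if there is a constant $C$ (independent of $f$) with $\lVert Vf\rVert_1\le C\lVert f\rVert_1$ for all $f\in L^1(X,m)$. Variation and oscillation norms, evaluated pointwise in $x\in X$: for a family $\{a_n\}_{n\in J}$ of scalars indexed by a set $J$ of positive integers, $\lVert\{a_n\}\rVert_{v(s)}=\sup\big(\sum_j|a_{m_j}-a_{m_{j+1}}|^s\big)^{1/s}$, the supremum being over all (finite or infinite) increasing sequences $\{m_j\}$ in $J$ ($J=\{1,2,\dots\}$ if not indicated). For a given increasing sequence $\{n_k\}$ of positive integers, $\lVert\{a_n\}\rVert_{o(s)}=\big(\sum_k\max_{n_k\le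 n\le n_{k+1}}|a_n-a_{n_k}|^s\big)^{1/s}$. The notation $n_{k+1}-n_k\sim n_k^{\alpha}$ means that there are constants $c_1,c_2>0$ with $c_1n_k^\alpha\le n_{k+1}-n_k\le c_2n_k^\alpha$ for all $k$. *)

(* Defs.v *)
From HB Require Import structures.
From mathcomp Require Import all_boot all_order all_algebra.
From mathcomp Require Import generic_quotient ring_quotient complex.
From mathcomp Require Import all_classical all_reals all_analysis.
From mathcomp Require Import measurable_realfun.

Set Implicit Arguments.
Unset Strict Implicit.
Unset Printing Implicit Defensive.
Import Order.TTheory GRing.Theory Num.Theory.
Import numFieldNormedType.Exports.

Local Open Scope classical_set_scope.
Local Open Scope ring_scope.

(* L^1(X, m) may be a real or a complex Banach space: everything is defined
   over scalar R k, which is R or R[i]. *)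
Variant scalar_kind := RealScalars | ComplexScalars.

Section Scalars.
Context (R : realType) (k : scalar_kind).

Definition scalar : numFieldType :=
  if k is RealScalars then R : numFieldType else R[i].

Definition of_real : R -> scalar :=
  match k return R -> (if k is RealScalars then R : numFieldType else R[i]) with
  | RealScalars => id
  | ComplexScalars => fun a => a%:C%C
  end.

Definition re : scalar -> R :=
  match k return (if k is RealScalars then R : numFieldType else R[i]) -> R with
  | RealScalars => id
  | ComplexScalars => @complex.Re R
  end.

Definition im : scalar -> R :=
  match k return (if k is RealScalars then R : numFieldType else R[i]) -> R with
  | RealScalars => fun=> 0
  | ComplexScalars => @complex.Im R
  end.

(* In MathComp `|x| is an element of scalar R k; modulus x is the same number
   as an element of R (see of_realK below). *)
Definition modulus (x : scalar) : R := re `|x|.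

End Scalars.

Section ScalarTheory.
Context (R : realType).
Implicit Types (k : scalar_kind).

Lemma re0 k : re (0 : scalar R k) = 0. Proof. by case: k. Qed.
Lemma im0 k : im (0 : scalar R k) = 0. Proof. by case: k. Qed.
Lemma reD k (x y : scalar R k) : re (x + y) = re x + re y.
Proof. by case: k x y => //= -[a b] [c e]. Qed.
Lemma imD k (x y : scalar R k) : im (x + y) = im x + im y.
Proof. by case: k x y => /= [x y|[a b] [c e]//]; rewrite addr0. Qed.
Lemma reM k (x y : scalar R k) : re (x * y) = re x * re y - im x * im y.
Proof. by case: k x y => /= [x y|[a b] [c e]//]; rewrite mulr0 subr0. Qed.
Lemma imM k (x y : scalar R k) : im (x * y) = re x * im y + im x * re y.
Proof. by case: k x y => /= [x y|[a b] [c e]//]; rewrite mulr0 mul0r addr0. Qed.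

Lemma of_realK k (x : scalar R k) : of_real k (modulus x) = `|x|.
Proof. by case: k x. Qed.
Lemma of_realD k (a b : R) : of_real k (a + b) = of_real k a + of_real k b.
Proof. by case: k => //=; exact: rmorphD. Qed.
Lemma of_realM k (a b : R) : of_real k (a * b) = of_real k a * of_real k b.
Proof. by case: k => //=; exact: rmorphM. Qed.
Lemma ler_of_real k (a b : R) : (of_real k a <= of_real k b) = (a <= b).
Proof. by case: k => //=; rewrite lecR. Qed.
Lemma of_real_inj k : injective (of_real k : R -> _).
Proof. by case: k => //= a b [->]. Qed.
Lemma of_real0 k : of_real k (0 : R) = 0. Proof. by case: k. Qed.

Lemma modulus_ge0 k (x : scalar R k) : 0 <= modulus x.
Proof. by rewrite -(ler_of_real k) of_realK of_real0. Qed.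
Lemma modulus0 k : modulus (0 : scalar R k) = 0.
Proof. by apply: (@of_real_inj k); rewrite of_realK normr0 of_real0. Qed.
Lemma modulus_eq0 k (x : scalar R k) : modulus x = 0 -> x = 0.
Proof. by move=> /(congr1 (of_real k)); rewrite of_realK of_real0 => /normr0_eq0. Qed.
Lemma modulusM k (x y : scalar R k) : modulus (x * y) = modulus x * modulus y.
Proof. by apply: (@of_real_inj k); rewrite of_realM !of_realK normrM. Qed.
Lemma ler_modulusD k (x y : scalar R k) : modulus (x + y) <= modulus x + modulus y.
Proof. by rewrite -(ler_of_real k) of_realD !of_realK ler_normD. Qed.
Lemma modulusE k (x : scalar R k) : modulus x = Num.sqrt (re x ^+ 2 + im x ^+ 2).
Proof. by case: k x => [x|[a b]//]; rewrite /= expr0n/= addr0 sqrtr_sqr. Qed.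
Lemma modulus_le k (x : scalar R k) : modulus x <= `|re x| + `|im x|.
Proof.
rewrite modulusE -[leRHS]ger0_norm ?addr_ge0// -sqrtr_sqr ler_sqrt ?sqr_ge0//.
by rewrite sqrrD !real_normK ?num_real// -addrAC lerDl mulrn_wge0// mulr_ge0.
Qed.
End ScalarTheory.

Section L1fun.
Context d (X : measurableType d) (R : realType)
  (m : {measure set X -> \bar R}) (k : scalar_kind).

Definition integrable_scalar (f : X -> scalar R k) :=
  m.-integrable setT (fun x => (re (f x))%:E) /\
  m.-integrable setT (fun x => (im (f x))%:E).

Definition L1pred : {pred X -> scalar R k} :=
  fun f => `[< integrable_scalar f >].

Lemma L1pred_submod : submod_closed L1pred.
Proof.
split.
  apply/asboolP; split.
    under eq_fun do rewrite re0; exact: integrable0.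
  by under eq_fun do rewrite im0; exact: integrable0.
move=> c f g /asboolP[rf jf] /asboolP[rg jg]; apply/asboolP; split.
  under eq_fun.
    move=> x; have -> : re ((c *: f + g) x) =
      re c * re (f x) - im c * im (f x) + re (g x) by rewrite reD reM.
    rewrite EFinD EFinB !EFinM.
    over.
  by apply: integrableD => //; apply: integrableB => //; exact: integrableZl.
under eq_fun.
  move=> x; have -> : im ((c *: f + g) x) =
    re c * im (f x) + im c * re (f x) + im (g x) by rewrite imD imM.
  rewrite 2!EFinD !EFinM.
  over.
by apply: integrableD => //; apply: integrableD => //; exact: integrableZl.
Qed.
HB.instance Definition _ := GRing.isSubmodClosed.Build _ _ L1pred L1pred_submod.

Record L1fun :=
  MkL1fun { L1fun_val :> X -> scalar R k ; _ : L1fun_val \in L1pred }.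
HB.instance Definition _ := [isSub for L1fun_val].
HB.instance Definition _ := [Choice of L1fun by <:].
HB.instance Definition _ := [SubChoice_isSubLmodule of L1fun by <:].

Lemma L1funDE (f g : L1fun) x : (f + g) x = f x + g x. Proof. by []. Qed.
Lemma L1funBE (f g : L1fun) x : (f - g) x = f x - g x. Proof. by []. Qed.
Lemma L1funZE c (f : L1fun) x : (c *: f) x = c * f x. Proof. by []. Qed.
Lemma L1funP (f : L1fun) : integrable_scalar f.
Proof. by apply/asboolP; case: f. Qed.

Definition ae0 : {pred L1fun} := fun f => `[< {ae m, forall x, f x = 0} >].

Lemma ae0_zmod : zmod_closed ae0.
Proof.
split; first by apply/asboolP; apply: nearW => x.
move=> f g /asboolP f0 /asboolP g0; apply/asboolP.
apply: filterS2 f0 g0 => x fx gx.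
by rewrite L1funBE fx gx subrr.
Qed.
HB.instance Definition _ := GRing.isZmodClosed.Build _ ae0 ae0_zmod.

(* The quotient of the integrable functions by the a.e. null ones. *)
Definition L1 : Type := {ideal_quot ae0}.
HB.instance Definition _ := GRing.Zmodule.on L1.
HB.instance Definition _ := ZmodQuotient.on L1.

Local Open Scope quotient_scope.

Lemma L1eqP (f g : L1fun) :
  \pi_L1 f = \pi_L1 g <-> {ae m, forall x, f x = g x}.
Proof.
split => [/eqP|fg].
  rewrite -[_ == _]/(f == g %[mod {ideal_quot ae0}]) -Quotient.idealrBE.
  move=> /asboolP; apply: filterS => x.
  by rewrite L1funBE => /subr0_eq.
apply/eqP; rewrite -[_ == _]/(f == g %[mod {ideal_quot ae0}]) -Quotient.idealrBE.
apply/asboolP; apply: filterS fg => x fg.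
by rewrite L1funBE fg subrr.
Qed.

Lemma L1reprP (f : L1fun) : {ae m, forall x, repr (\pi_L1 f) x = f x}.
Proof. by apply/L1eqP; rewrite reprK. Qed.

Definition L1scale (c : scalar R k) (f : L1) : L1 := \pi_L1 (c *: repr f).

Lemma L1scaleE c (f : L1fun) : L1scale c (\pi_L1 f) = \pi_L1 (c *: f).
Proof.
apply/L1eqP; apply: filterS (L1reprP f) => x fx.
by rewrite !L1funZE fx.
Qed.

Lemma piL1D (f g : L1fun) : \pi_L1 f + \pi_L1 g = \pi_L1 (f + g).
Proof. by rewrite [RHS](@pi_addr _ _ _ _ _ L1). Qed.

Lemma L1scaleA a b f : L1scale a (L1scale b f) = L1scale (a * b) f.
Proof. by elim/quotW: f => f; rewrite (L1scaleE b) !L1scaleE scalerA. Qed.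
Lemma L1scale1 : left_id 1 L1scale.
Proof. by elim/quotW => f; rewrite L1scaleE scale1r. Qed.
Lemma L1scaleDr : right_distributive L1scale +%R.
Proof.
move=> c; elim/quotW => f; elim/quotW => g.
by rewrite piL1D !L1scaleE piL1D scalerDr.
Qed.
Lemma L1scaleDl f : {morph L1scale^~ f : a b / a + b}.
Proof. by move=> a b; elim/quotW: f => f; rewrite !L1scaleE piL1D scalerDl. Qed.
HB.instance Definition _ := GRing.Zmodule_isLmodule.Build (scalar R k) L1
  L1scaleA L1scale1 L1scaleDr L1scaleDl.

Definition L1norm_of (f : X -> scalar R k) : \bar R :=
  (\int[m]_x (modulus (f x))%:E)%E.

(* MathComp norms on a module over scalar R k take values in scalar R k. *)
Definition L1norm (f : L1) : scalar R k := of_real k (fine (L1norm_of (repr f))).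

Lemma measurable_modulus (f : X -> scalar R k) : integrable_scalar f ->
  measurable_fun setT (fun x => modulus (f x)).
Proof.
move=> [/measurable_int/measurable_EFinP mr /measurable_int/measurable_EFinP mi].
under eq_fun do rewrite modulusE -powR12_sqrt ?addr_ge0 ?sqr_ge0//.
apply: measurableT_comp (measurable_powR _) _.
by apply: measurable_funD; exact: measurable_funX.
Qed.

Lemma measurable_L1fun (f : L1fun) :
  measurable_fun setT (fun x => (modulus (f x))%:E).
Proof. by apply/measurable_EFinP/measurable_modulus/L1funP. Qed.

Lemma L1norm_of_ge0 f : (0 <= L1norm_of f)%E.
Proof. by apply: integral_ge0 => x _; rewrite lee_fin modulus_ge0. Qed.

Lemma L1norm_of_fin (f : L1fun) : (L1norm_of f) \is a fin_num.
Proof.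
have fi := L1funP f.
have [ir ii] := fi.
rewrite ge0_fin_numE ?L1norm_of_ge0//.
have ii' : m.-integrable setT
   (fun x => (`|re (f x)|%:E + `|im (f x)|%:E)%E).
  by apply: integrableD => //; exact: integrable_norm.
have /integrableP[_] := ii'; apply: le_lt_trans.
have mm := measurable_modulus fi.
have [mr mi] := (measurable_int _ ir, measurable_int _ ii).
apply: ge0_le_integral => //.
- by move=> x _; rewrite lee_fin modulus_ge0.
- exact/measurable_EFinP.
- by apply: measurableT_comp => //; exact: measurable_int ii'.
- move=> x _; rewrite -EFinD /= lee_fin [leRHS]ger0_norm ?addr_ge0//.
  exact: modulus_le.
Qed.

Lemma eq_L1norm_of (f g : L1fun) : {ae m, forall x, f x = g x} ->
  L1norm_of f = L1norm_of g.
Proof.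
move=> fg; apply: ae_eq_integral => //.
- exact: measurable_L1fun.
- exact: measurable_L1fun.
- by apply: filterS fg => x -> _.
Qed.

Lemma ler_L1normD (f g : L1) : L1norm (f + g) <= L1norm f + L1norm g.
Proof.
rewrite -of_realD ler_of_real -fineD ?L1norm_of_fin// fine_le//.
- by rewrite L1norm_of_fin.
- by rewrite fin_numD !L1norm_of_fin.
rewrite (@eq_L1norm_of _ (repr f + repr g)); last first.
  by apply/L1eqP; rewrite reprK -piL1D !reprK.
rewrite /L1norm_of -ge0_integralD//; last 4 first.
- by move=> x _; rewrite lee_fin modulus_ge0.
- exact: measurable_L1fun.
- by move=> x _; rewrite lee_fin modulus_ge0.
- exact: measurable_L1fun.
apply: ge0_le_integral => //.
- by move=> x _; rewrite lee_fin modulus_ge0.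
- exact: measurable_L1fun.
- by apply: emeasurable_funD; exact: measurable_L1fun.
- by move=> x _; rewrite -EFinD lee_fin; exact: ler_modulusD.
Qed.

Lemma L1normZ (c : scalar R k) (f : L1) : L1norm (c *: f) = `|c| * L1norm f.
Proof.
rewrite -of_realK -of_realM; congr of_real.
have -> : c *: f = \pi_L1 (c *: repr f) by [].
rewrite (eq_L1norm_of (L1reprP _)) /L1norm_of.
under eq_integral.
  move=> x _; rewrite L1funZE modulusM EFinM; over.
rewrite ge0_integralZl ?lee_fin ?modulus_ge0//.
- by rewrite fineM// L1norm_of_fin.
- exact: measurable_L1fun.
- by move=> x _; rewrite lee_fin modulus_ge0.
Qed.

Lemma L1norm0_eq0 (f : L1) : L1norm f = 0 -> f = 0.
Proof.
rewrite -(of_real0 R k) => /of_real_inj/eqP.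
rewrite fine_eq0 ?L1norm_of_fin// => /eqP f0.
have -> : 0 = \pi_L1 0 by rewrite (@pi_zeror _ _ _ _ _ L1).
rewrite -[LHS]reprK; apply/L1eqP.
have /ae_eq_integral_abs := measurable_L1fun (repr f).
move=> /(_ m measurableT)[+ _].
have -> : (\int[m]_(x in setT) `|(modulus (repr f x))%:E|)%E = 0%E.
  rewrite -[RHS]f0; apply: eq_integral => x _.
  by rewrite gee0_abs ?lee_fin ?modulus_ge0.
by move=> /(_ erefl); apply: filterS => x /(_ I) [] /modulus_eq0 ->.
Qed.

HB.instance Definition _ := Lmodule_isNormed.Build (scalar R k) L1
  ler_L1normD L1normZ L1norm0_eq0.

(* A fixed representative of the class f. *)
Definition eval_L1 (f : L1) : X -> scalar R k := repr f.

End L1fun.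

Section Ritt.
Context (K : numFieldType) (V : normedModType K).

(* The case n = 1 says that T is bounded. *)
Definition power_bounded (T : V -> V) :=
  exists C : K, forall n f, `|iter n T f| <= C * `|f|.

Definition ritt (T : {linear V -> V}) :=
  power_bounded T /\
  exists C : K, forall n f,
    n%:R * `|iter n T f - iter n.+1 T f| <= C * `|f|.

End Ritt.

Section FractionalPowers.
Context (R : realType) (k : scalar_kind) (V : normedModType (scalar R k)).
Implicit Types (T : V -> V) (f : V).

Definition binom_coef (theta : R) (j : nat) : R :=
  (\prod_(i < j) `|theta - i%:R|) / j`!%:R.

(* (I - T)^theta f for 0 <= theta < 1. *)
Definition frac_power T (theta : R) f : V :=
  if theta == 0 then f
  else f - limn (fun N =>
         \sum_(1 <= j < N) of_real k (binom_coef theta j) *: iter j T f).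

(* (I - T)^r f for r >= 0; Num.truncn r is then the integer part of r. *)
Definition real_power T (r : R) f : V :=
  iter (Num.truncn r) (fun g => g - T g)
    (frac_power T (r - (Num.truncn r)%:R) f).

End FractionalPowers.

Section VariationOscillation.
Context (R : realType) (k : scalar_kind).
Implicit Types (s : R) (a : nat -> scalar R k) (J : set nat).

(* The supremum runs over the finite sequences m 0 < ... < m N and the infinite
   sequences m 0 < m 1 < ... with values in J. *)
Definition variation_norm s J a : \bar R := ereal_sup (
  [set v | exists N (m : nat -> nat),
     [/\ forall j, (j <= N)%N -> J (m j),
         forall j, (j < N)%N -> (m j < m j.+1)%N
       & v = ((\sum_(0 <= j < N)
                 (modulus (a (m j) - a (m j.+1)) `^ s)%:E) `^ s^-1)%E]] `|`
  [set v | exists m : nat -> nat,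
     [/\ forall j, J (m j),
         forall j, (m j < m j.+1)%N
       & v = ((\sum_(0 <= j <oo)
                 (modulus (a (m j) - a (m j.+1)) `^ s)%:E) `^ s^-1)%E]]).

Definition oscillation_norm s (nk : nat -> nat) a : \bar R :=
  ((\sum_(0 <= i <oo)
      ((\big[Num.max/0%R]_(nk i <= n < (nk i.+1).+1)
          modulus (a n - a (nk i))) `^ s)%:E) `^ s^-1)%E.

End VariationOscillation.

Definition increasing_positive (nk : nat -> nat) :=
  (forall i, 0 < nk i)%N /\ (forall i, nk i < nk i.+1)%N.

(* n_{i+1} - n_i ~ n_i^alpha *)
Definition gaps_like (R : realType) (nk : nat -> nat) (alpha : R) :=
  exists c1 c2 : R, [/\ 0 < c1, 0 < c2 & forall i,
    c1 * (nk i)%:R `^ alpha <= (nk i.+1)%:R - (nk i)%:R <=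
    c2 * (nk i)%:R `^ alpha].

Definition bounded_in_L1 d (X : measurableType d) (R : realType)
    (m : {measure set X -> \bar R}) (k : scalar_kind)
    (V : L1 m k -> X -> \bar R) :=
  exists C : R, forall f : L1 m k,
    measurable_fun setT (V f) /\
    (\int[m]_x V f x <= C%:E * L1norm_of m (eval_L1 f))%E.

(* Main.v *)
Require Import Defs.
From HB Require Import structures.
From mathcomp Require Import all_boot all_order all_algebra.
From mathcomp Require Import all_classical all_reals all_analysis.
From mathcomp Require Import measurable_realfun.
From mathcomp Require Import ring lra.

(** The single fact about T behind all the estimates is the polynomial decay of
    the norm of T^n (I - T)^r, at most a constant times n^-r for every real
    r > 0 ([real_power_decay]). For integer r it follows by distributing the n
    iterates among the factors I - T ([iter_diff_decay]). For a fractional part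
    theta, summation by parts in the binomial series rewrites (I - T)^theta as
    the sum of s_j T^j (I - T), where s_j is the tail of the coefficients and is
    at most (j+1)^-theta; the Ritt condition then leaves the convolution of
    (j+1)^-theta with 1/(n+j+1), which is of order n^-theta
    ([frac_power_abel], [sum_powR_convolution], [frac_power_decay]). The series
    converges because L^1 is complete ([L1_series_cvgn]).

    Now put a_n = T^n (I - T)^r f. The norm of a_n is of order n^-r, and that of
    a_n - a_(n+1) is of order n^(-r-1), by the same decay with r + 1. For
    0 <= beta < r the increments of n^beta a_n therefore have norms of order
    n^(beta-r-1), which is summable, so that the total variation of n^beta a_n
    is integrable ([integral_total_variation]). It dominates the supremum of
    n^beta |a_n|, all the variation norms (s >= 1), and all the oscillation
    norms. For the square functions, the weighted s-th powers are a product of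
    s - 1 factors n^gamma |a_n|, bounded uniformly by such a total variation,
    and one factor n^delta |a_n|, whose sum is integrable as soon as
    delta + 1 < r ([root_sum_le], [root_weighted_series_le]); the choice of
    gamma slightly below r reaches every exponent with alpha + 1 < s r.

    For the sums along n_k, everything is dominated by the block sums of
    |T^n f - T^(n+1) f| over n_k <= n < n_(k+1): both differences and maxima,
    and also the s-variation over a block, which is at most the 1-variation.
    The increments T^n (I - T) f are a sequence of the above kind with r = 1,
    and the same interpolation applies to their block sums
    ([root_block_sum_le]), since a block of length of order n_k^alpha is short
    compared with n_k. *)

Set Implicit Arguments.
Unset Strict Implicit.
Unset Printing Implicit Defensive.
Import Order.TTheory GRing.Theory Num.Theory.
Import numFieldNormedType.Exports.

Local Open Scope classical_set_scope.
Local Open Scope ring_scope.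

Local Notation scalar := Defs.scalar.

(** * Power weights *)

Section PowerWeights.
Context {R : realType}.
Implicit Types (x p theta eps beta : R) (n m : nat).

Lemma powRDn n p q : n.+1%:R `^ (p + q) = n.+1%:R `^ p * n.+1%:R `^ q :> R.
Proof. by rewrite powRD// pnatr_eq0 implybT. Qed.

Lemma natS_ratio n : let z : R := 1 - n.+2%:R^-1 in
  0 < z /\ n.+1%:R = n.+2%:R * z.
Proof.
split; first by rewrite subr_gt0 invf_lt1 ?ltr0n// ltr1n.
by rewrite mulrBr mulr1 divff ?pnatr_eq0// -(natr1 n.+1) addrK.
Qed.

(** With x = 1 - 1/(n+2) or its inverse this compares consecutive powers
    without differentiating: it is 1 + t <= exp t at t = p ln x. *)
Lemma powR_ge1Dln x p : 0 < x -> 1 + p * ln x <= x `^ p.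
Proof.
by move=> x0; rewrite /powR gt_eqF// expR_ge1Dx.
Qed.

(** Concavity of x^p for 0 < p < 1, read off from the Young inequality with
    second factor 1. *)
Lemma powR_le_young x p : 0 < x -> 0 < p -> p < 1 -> x `^ p <= 1 + p * (x - 1).
Proof.
move=> x0 p0 p1.
have := @conjugate_powR R (x `^ p) 1 p^-1 (1 - p)^-1 (powR_ge0 _ _) ler01.
rewrite !invrK mulr1 -powRrM divff ?gt_eqF// powRr1 ?(ltW x0)//.
rewrite powR1 mul1r !invr_gt0 subr_gt0 => /(_ p0 p1); rewrite subrKC => /(_ erefl).
lra.
Qed.

(** A discrete mean value inequality. The constant 2 comes from
    ln (1 - u) >= - u / (1 - u) >= - 2 u, where u = 1/(n+2) <= 1/2; this makes
    the same bound hold for beta below and above 1. *)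
Lemma powR_succ_sub beta n : 0 <= beta ->
  n.+2%:R `^ beta - n.+1%:R `^ beta <= 2 * beta * n.+2%:R `^ (beta - 1) :> R.
Proof.
move=> b0; set y : R := n.+2%:R.
have y0 : 0 < y by rewrite ltr0n.
have y2 : 2 <= y by rewrite ler_nat.
have [z0 n1] := natS_ratio n; rewrite -/y in z0 n1.
clearbody y; set z : R := 1 - y^-1 in z0 n1.
have zpos : z^-1 - 1 <= 2 * y^-1.
  have -> : z^-1 - 1 = y^-1 * z^-1.
    rewrite -[X in _ - X](divff (lt0r_neq0 z0)) -[X in X - _]mul1r -mulrBl.
    by rewrite {1}/z opprB addrC subrK.
  have yi : y^-1 <= 2^-1 by rewrite lef_pV2 ?posrE.
  rewrite mulrC ler_wpM2r ?invr_ge0 ?(ltW y0)// -[leRHS]invrK.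
  by rewrite lef_pV2 ?posrE ?invr_gt0// /z; lra.
have lnz : - (2 * y^-1) <= ln z.
  rewrite lerNl -lnV ?posrE//.
  have := @le_ln1Dx R (z^-1 - 1); rewrite subrKC.
  have : 0 < z^-1 by rewrite invr_gt0.
  by move=> zi /(_ ltac:(lra)); lra.
have h := @powR_ge1Dln z beta z0.
have h2 : 1 - z `^ beta <= 2 * beta * y^-1.
  have : beta * - (2 * y^-1) <= beta * ln z by rewrite ler_wpM2l.
  lra.
rewrite n1 powRM ?(ltW y0) ?(ltW z0)// powRB ?(gt_eqF y0) ?implybT// powRr1 ?(ltW y0)//.
have -> : y `^ beta - y `^ beta * z `^ beta = y `^ beta * (1 - z `^ beta) by ring.
have -> : 2 * beta * (y `^ beta / y) = y `^ beta * (2 * beta * y^-1) by ring.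
by rewrite ler_wpM2l ?powR_ge0.
Qed.

(** Comparing n^(-1-eps) with a telescoping difference replaces the integral
    test for the tails of the series below. *)
Lemma powR_telescope eps n : 0 < eps ->
  eps * n.+2%:R `^ (- 1 - eps) <= n.+1%:R `^ (- eps) - n.+2%:R `^ (- eps) :> R.
Proof.
move=> e0; set y : R := n.+2%:R.
have y0 : 0 < y by rewrite ltr0n.
have [z0 n1] := natS_ratio n; rewrite -/y in z0 n1.
clearbody y; set z : R := 1 - y^-1 in z0 n1.
have yi : 0 < y^-1 by rewrite invr_gt0.
have lnz : ln z <= - y^-1.
  by have := @le_ln1Dx R (- y^-1); apply; move: z0; rewrite /z; lra.
have h := @powR_ge1Dln z (- eps) z0.
have h2 : eps * y^-1 <= z `^ (- eps) - 1.
  have : eps * ln z <= eps * - y^-1 by rewrite ler_wpM2l// ltW.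
  lra.
rewrite n1 powRM ?(ltW y0) ?(ltW z0)// powRD ?(gt_eqF y0) ?implybT// powR_inv1 ?(ltW y0)//.
rewrite -[X in _ <= _ - X]mulr1 -mulrBr mulrA mulrC.
by rewrite ler_wpM2l ?powR_ge0.
Qed.

Lemma sum_powR_tail eps m N : 0 < eps ->
  \sum_(m.+1 <= i < N) i.+1%:R `^ (- 1 - eps) <= m.+1%:R `^ (- eps) / eps :> R.
Proof.
move=> e0; rewrite ler_pdivlMr// mulr_suml.
have [mN|Nm] := leqP m.+1 N; last by rewrite big_geq ?powR_ge0// ltnW.
apply: (@le_trans _ _
  (\sum_(m.+1 <= i < N) (- (i.+1%:R `^ (- eps)) - - (i%:R `^ (- eps))))).
  rewrite big_nat_cond [leRHS]big_nat_cond.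
  apply: ler_sum => -[|i] /andP[/andP[]]// _ _ _.
  by rewrite mulrC opprK [leRHS]addrC powR_telescope.
by rewrite telescope_sumr// opprK addrC gerBl powR_ge0.
Qed.

Lemma sum_powR_le eps N : 0 < eps ->
  \sum_(0 <= i < N) i.+1%:R `^ (- 1 - eps) <= 1 + eps^-1 :> R.
Proof.
move=> e0; case: N => [|N]; first by rewrite big_geq// addr_ge0// invr_ge0 ltW.
rewrite big_ltn// powR1 lerD2l; apply: (le_trans (sum_powR_tail _ _ e0)).
by rewrite powR1 mul1r.
Qed.

Lemma sum_powR_head p m : 0 < p -> p < 1 ->
  \sum_(0 <= i < m) i.+1%:R `^ (p - 1) <= m%:R `^ p / p :> R.
Proof.
move=> p0 p1; elim: m => [|m IH].
  by rewrite big_geq// divr_ge0 ?powR_ge0 ?ltW.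
rewrite big_nat_recr//=; apply: le_trans (lerD IH (lexx _)) _.
rewrite -lerBrDl -mulrBl ler_pdivlMr//.
case: m {IH} => [|m].
  by rewrite !powR1 mul1r powR0 ?subr0 ?ltW// gt_eqF.
set y : R := m.+2%:R.
have y0 : 0 < y by rewrite ltr0n.
have [z0 n1] := natS_ratio m; rewrite -/y in z0 n1.
clearbody y; set z : R := 1 - y^-1 in z0 n1.
have h := powR_le_young z0 p0 p1.
rewrite n1 powRM ?(ltW y0) ?(ltW z0)// powRB ?(gt_eqF y0) ?implybT// powRr1 ?(ltW y0)//.
rewrite -mulrA -[X in _ <= X - _]mulr1 -mulrBr ler_wpM2l ?powR_ge0//.
by have : p * (z - 1) = - (y^-1 * p) by [rewrite /z; ring|]; lra.
Qed.

(** The discrete convolution estimate behind the decay of a fractional power.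
    Below n the second factor is at most (n+1)^-1 and the first one sums to
    (n+1)^(1-theta); above n the product is at most (k+1)^(-1-theta), whose
    tail is of order (n+1)^-theta. *)
Lemma sum_powR_convolution theta n N : 0 < theta -> theta < 1 ->
  \sum_(0 <= k < N) k.+1%:R `^ (- theta) * (n + k).+1%:R^-1 <=
  ((1 - theta)^-1 + theta^-1) * n.+1%:R `^ (- theta) :> R.
Proof.
move=> t0 t1.
pose F k : R := k.+1%:R `^ (- theta) * (n + k).+1%:R^-1.
have F0 k : 0 <= F k by rewrite mulr_ge0 ?powR_ge0 ?invr_ge0.
have n0 : 0 < n.+1%:R :> R by rewrite ltr0n.
apply: (@le_trans _ _ (\sum_(0 <= k < n.+1 + N) F k)).
  by rewrite [leRHS](big_cat_nat (n := N))//= ?leq_addl// lerDl sumr_ge0.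
rewrite (big_cat_nat (n := n.+1))//= ?leq_addr// mulrDl lerD//.
  apply: (@le_trans _ _ (\sum_(0 <= k < n.+1) n.+1%:R^-1 * k.+1%:R `^ ((1 - theta) - 1))).
    apply: ler_sum => k _; rewrite /F mulrC addrAC subrr sub0r ler_wpM2r ?powR_ge0//.
    by rewrite lef_pV2 ?posrE ?ltr0n// ler_nat ltnS leq_addr.
  rewrite -mulr_sumr.
  have h := @sum_powR_head (1 - theta) n.+1.
  apply: (@le_trans _ _ (n.+1%:R^-1 * (n.+1%:R `^ (1 - theta) / (1 - theta)))).
    by rewrite ler_wpM2l ?invr_ge0// h; lra.
  rewrite powRDn powRr1 ?(ltW n0)// le_eqVlt; apply/orP; left; apply/eqP.
  by rewrite !mulrA mulVf ?gt_eqF// mul1r mulrC.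
apply: (@le_trans _ _ (\sum_(n.+1 <= k < n.+1 + N) k.+1%:R `^ (- 1 - theta))).
  apply: ler_sum => k _; rewrite /F powRDn mulrC powR_inv1// ler_wpM2r ?powR_ge0//.
  by rewrite lef_pV2 ?posrE ?ltr0n// ler_nat ltnS leq_addl.
by rewrite [leRHS]mulrC sum_powR_tail.
Qed.

End PowerWeights.

(** * Coefficients of the fractional power *)

Section Coefficients.
Context {R : realType}.
Implicit Types (theta : R) (n : nat).

(** What remains of the total mass 1 of the coefficients after the first n of
    them: 1 - g(theta,1) - ... - g(theta,n), in closed form. *)
Definition binom_tail theta n : R := \prod_(j < n) (1 - theta / j.+1%:R).

Lemma binom_tailS theta n :
  binom_tail theta n.+1 = binom_tail theta n * (1 - theta / n.+1%:R).
Proof. by rewrite /binom_tail big_ord_recr. Qed.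

Lemma binom_tail0 theta : binom_tail theta 0 = 1.
Proof. by rewrite /binom_tail big_ord0. Qed.

Lemma binom_coefSE theta n : 0 < theta -> theta < 1 ->
  binom_coef theta n.+1 = binom_tail theta n * (theta / n.+1%:R).
Proof.
move=> t0 t1; elim: n => [|n IH].
  by rewrite binom_tail0 /binom_coef big_ord1 subr0 gtr0_norm// -[1`!]/1%N !divr1 mul1r.
have -> : binom_coef theta n.+2 =
    binom_coef theta n.+1 * (`|theta - n.+1%:R| / n.+2%:R).
  by rewrite /binom_coef big_ord_recr/= factS natrM invfM; ring.
rewrite IH binom_tailS distrC gtr0_norm; last first.
  by rewrite subr_gt0 (lt_le_trans t1)// ler1n.
have n1 : n.+1%:R != 0 :> R by rewrite pnatr_eq0.
have n2 : n.+2%:R != 0 :> R by rewrite pnatr_eq0.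
set a : R := n.+1%:R in n1 *; set b : R := n.+2%:R in n2 *.
clearbody a b.
by field; rewrite n2 n1.
Qed.

Lemma binom_coef_tail theta n : 0 < theta -> theta < 1 ->
  binom_coef theta n.+1 = binom_tail theta n - binom_tail theta n.+1.
Proof. by move=> t0 t1; rewrite binom_coefSE// binom_tailS; ring. Qed.

Lemma binom_tail_ge0 theta n : theta < 1 -> 0 <= binom_tail theta n.
Proof.
move=> t1; apply: prodr_ge0 => i _.
by rewrite subr_ge0 ler_pdivrMr ?ltr0n// mul1r (le_trans (ltW t1))// ler1n.
Qed.

Lemma binom_coef_ge0 theta n : 0 <= binom_coef theta n :> R.
Proof. by rewrite divr_ge0//; apply: prodr_ge0. Qed.

(** 1 - theta/(j+1) is at most ((j+1)/(j+2))^theta, and the product of these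
    bounds telescopes. In particular the coefficients have total mass 1. *)
Lemma binom_tail_le theta n : 0 < theta -> theta < 1 ->
  binom_tail theta n <= n.+1%:R `^ (- theta).
Proof.
move=> t0 t1; elim: n => [|n IH]; first by rewrite binom_tail0 powR1.
have n0 : 0 < n.+1%:R :> R by rewrite ltr0n.
rewrite binom_tailS.
have h : 1 - theta / n.+1%:R <= (n.+2%:R / n.+1%:R) `^ (- theta).
  have x0 : 0 < n.+2%:R / n.+1%:R :> R by rewrite divr_gt0// ltr0n.
  apply: le_trans (powR_ge1Dln (- theta) x0); rewrite mulNr lerD2l lerN2.
  rewrite ler_wpM2l ?(ltW t0)//.
  have -> : n.+2%:R / n.+1%:R = 1 + n.+1%:R^-1 :> R.
    by rewrite -(natr1 n.+1) mulrDl divff ?gt_eqF// mul1r.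
  by apply: le_ln1Dx; rewrite (lt_trans (ltrN10 _))// invr_gt0.
apply: (@le_trans _ _ (n.+1%:R `^ (- theta) * (n.+2%:R / n.+1%:R) `^ (- theta))).
  apply: ler_pM => //; first exact: binom_tail_ge0.
  by rewrite subr_ge0 ler_pdivrMr// mul1r (le_trans (ltW t1))// ler1n.
by rewrite -powRM ?divr_ge0// mulrC divfK// gt_eqF.
Qed.

Lemma powR_natS_small theta eps : 0 < theta -> 0 < eps ->
  exists n0, forall n, (n0 <= n)%N -> n.+1%:R `^ (- theta) <= eps :> R.
Proof.
move=> t0 e0; exists (Num.truncn (eps^-1 `^ theta^-1)) => n hn.
have y0 : 0 <= eps^-1 `^ theta^-1 by exact: powR_ge0.
have h : eps^-1 `^ theta^-1 <= n.+1%:R.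
  by apply: (le_trans (ltW (truncnS_gt _))); rewrite ler_nat ltnS.
have := ge0_ler_powR (ltW t0) _ _ h; rewrite !nnegrE => /(_ y0 (ler0n _ _)).
rewrite -powRrM mulVf ?gt_eqF// powRr1 ?invr_ge0 ?(ltW e0)// => h2.
by rewrite powRN -[leRHS]invrK lef_pV2// ?posrE ?invr_gt0// powR_gt0// ltr0n.
Qed.

End Coefficients.

(** * Decay of the orbits of a Ritt operator *)

Section ScalarNorm.
Context {R : realType} {k : scalar_kind}.

Lemma of_real_re (a : R) : re (of_real k a) = a. Proof. by case: k. Qed.

Lemma modulus_of_real (a : R) : modulus (of_real k a) = `|a|.
Proof.
rewrite modulusE of_real_re.
suff -> : im (of_real k a) = 0 by rewrite expr0n/= addr0 sqrtr_sqr.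
by case: k.
Qed.

Lemma ler_re (x y : scalar R k) : x <= y -> re x <= re y.
Proof. by case: k x y => // -[a b] [c e]; rewrite complex.lecE => /andP[]. Qed.

Lemma re_mul_real (x : scalar R k) (a : R) : re (x * of_real k a) = re x * a.
Proof.
rewrite reM of_real_re.
suff -> : im (of_real k a) = 0 by rewrite mulr0 subr0.
by case: k {x}.
Qed.

Lemma of_real1 : of_real k (1 : R) = 1. Proof. by case: k. Qed.

Lemma of_real_nat n : of_real k (n%:R : R) = n%:R.
Proof.
by elim: n => [|n IH]; [rewrite of_real0|rewrite -!natr1 of_realD IH of_real1].
Qed.

Context {V : normedModType (scalar R k)}.
Implicit Types f g : V.

(** The norm of V takes its values in the scalars, which may be complex; the
    estimates below need real numbers. *)
Definition rnorm f : R := re `|f|.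

Lemma rnormE f : `|f| = of_real k (rnorm f).
Proof. by rewrite -[LHS]normr_id -of_realK /modulus normr_id. Qed.

Lemma rnorm_ge0 f : 0 <= rnorm f.
Proof. by rewrite -(re0 R k); apply: ler_re. Qed.

Lemma ler_rnormD f g : rnorm (f + g) <= rnorm f + rnorm g.
Proof. by rewrite -reD; apply/ler_re/ler_normD. Qed.

Lemma rnormN f : rnorm (- f) = rnorm f.
Proof. by rewrite /rnorm normrN. Qed.

Lemma ler_rnormB f g : rnorm (f - g) <= rnorm f + rnorm g.
Proof. by rewrite (le_trans (ler_rnormD _ _))// rnormN. Qed.

Lemma rnorm0 : rnorm (0 : V) = 0. Proof. by rewrite /rnorm normr0 re0. Qed.

Lemma rnormZ (c : scalar R k) f : rnorm (c *: f) = modulus c * rnorm f.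
Proof. by rewrite /rnorm normrZ [`|f|]rnormE re_mul_real of_real_re. Qed.

Lemma rnormZ_real (a : R) f : 0 <= a -> rnorm (of_real k a *: f) = a * rnorm f.
Proof. by move=> a0; rewrite rnormZ modulus_of_real ger0_norm. Qed.

Lemma ler_rnorm_sum N (u : nat -> V) :
  rnorm (\sum_(0 <= i < N) u i) <= \sum_(0 <= i < N) rnorm (u i).
Proof.
elim: N => [|N IH]; first by rewrite !big_geq// rnorm0.
by rewrite !big_nat_recr//= (le_trans (ler_rnormD _ _))// lerD2r.
Qed.

Lemma cvgn_rnorm (u : nat -> V) l : u @ \oo --> l -> forall eps : R, 0 < eps ->
  exists n0, forall n, (n0 <= n)%N -> rnorm (l - u n) <= eps.
Proof.
move=> /cvgrPdist_le ul eps e0.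
have e0' : 0 < of_real k eps.
  rewrite lt_neqAle -(of_real0 R k) ler_of_real (ltW e0) andbT.
  by apply/eqP => /of_real_inj e; move: e0; rewrite e ltxx.
have [n0 _ h] := ul _ e0'.
exists n0 => n nn; rewrite -(of_real_re eps); apply: ler_re.
exact: h.
Qed.

Lemma cvgn_rnormP (u : nat -> V) l (e : nat -> R) :
  (forall n, rnorm (l - u n) <= e n) -> e @ \oo --> (0 : R) -> u @ \oo --> l.
Proof.
move=> ue /cvgrPdist_le e0; apply/cvgrPdist_le => eps eps0.
have epsE : eps = of_real k (re eps) :> scalar R k.
  by rewrite -{1}(gtr0_norm eps0) -of_realK /modulus (gtr0_norm eps0).
have eps_re0 : 0 < re eps.
  rewrite lt_neqAle; apply/andP; split; last by rewrite -(re0 R k) ler_re// ltW.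
  apply/eqP => e00; move: eps0; rewrite epsE -e00.
  by rewrite (of_real0 R k) ltxx.
apply: filterS (e0 _ eps_re0) => n /=; rewrite sub0r normrN => h.
rewrite rnormE epsE ler_of_real (le_trans (ue n))// (le_trans _ h)//.
exact: ler_norm.
Qed.

End ScalarNorm.

Section RittDecay.
Context {R : realType} {k : scalar_kind} {V : normedModType (scalar R k)}.
Context (T : {linear V -> V}).
Implicit Types (f g : V) (theta r : R) (n M : nat).

Let D (g : V) := g - T g.

(** Packaging T^n (I - T)^M as a linear map gives access to additivity and
    homogeneity of these composites. *)
Lemma iter_diff_linear n M :
  exists W : {linear V -> V}, forall f, W f = iter n T (iter M D f).
Proof.
elim: n => [|n [W hW]]; last by exists (T \o W) => f /=; rewrite hW.
elim: M => [|M [W hW]]; first by exists idfun.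
by exists (W \o (idfun \- T)) => f; rewrite /= hW /= -iterSr.
Qed.

Lemma iter_diffC n M f : iter n T (iter M D f) = iter M D (iter n T f).
Proof.
elim: M f => [//|M IH] f; rewrite !iterSr IH; congr (iter M D _).
have [W hW] := iter_diff_linear n 0.
by have := linearB W f (T f); rewrite !hW /= -iterSr iterS.
Qed.

Lemma iter_diffB n f : iter n T (D f) = iter n T f - iter n.+1 T f.
Proof.
have [W hW] := iter_diff_linear n 0.
by have := linearB W f (T f); rewrite !hW /= -iterSr.
Qed.

(** The hypothesis is stated with scalar constants; real ones are extracted,
    and the trivial bound on T^n (I - T) lets n+1 replace n, which includes
    the case n = 0. *)
Lemma ritt_rnorm : ritt T -> exists C : R, [/\ 0 <= C,
  forall n f, rnorm (iter n T f) <= C * rnorm f &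
  forall n f, rnorm (iter n T (D f)) <= C * n.+1%:R^-1 * rnorm f].
Proof.
move=> [[C1 h1] [C2 h2]].
have k1 n f : rnorm (iter n T f) <= `|re C1| * rnorm f.
  have := ler_re (h1 n f); rewrite [`|f|]rnormE re_mul_real => /le_trans; apply.
  by rewrite ler_wpM2r ?rnorm_ge0// ler_norm.
have k2 n f : n%:R * rnorm (iter n T (D f)) <= `|re C2| * rnorm f.
  rewrite iter_diffB; have := ler_re (h2 n f); rewrite mulrC [`|f|]rnormE [`|_ - _|]rnormE.
  rewrite -of_real_nat -of_realM of_real_re re_mul_real mulrC => /le_trans; apply.
  by rewrite ler_wpM2r ?rnorm_ge0// ler_norm.
pose C := `|re C1| + `|re C1| + `|re C2|.
exists C; split; first by rewrite !addr_ge0.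
  move=> n f; apply: le_trans (k1 n f) _; rewrite ler_wpM2r ?rnorm_ge0//.
  by rewrite /C -addrA lerDl addr_ge0.
move=> n f; rewrite mulrAC ler_pdivlMr ?ltr0n// mulrC -natr1 mulrDl mul1r.
rewrite /C addrC mulrDl; apply: lerD; last exact: k2.
by rewrite iter_diffB mulrDl (le_trans (ler_rnormB _ _))// lerD.
Qed.

(** Each factor I - T gains n^-1 once it is given a fixed proportion of the n
    iterates of T, with which it commutes. *)
Lemma iter_diff_decay C M : 0 <= C ->
  (forall n f, rnorm (iter n T f) <= C * rnorm f) ->
  (forall n f, rnorm (iter n T (D f)) <= C * n.+1%:R^-1 * rnorm f) ->
  exists2 K, 0 <= K & forall n f,
    rnorm (iter n T (iter M D f)) <= K * n.+1%:R `^ (- M%:R) * rnorm f.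
Proof.
move=> C0 hC hD; elim: M => [|M [K K0 IH]].
  by exists C => // n f; rewrite oppr0 powRr0 mulr1; exact: hC.
exists (K * C * 2 `^ (M.+1%:R)) => [|n f]; first by rewrite !mulr_ge0 ?powR_ge0.
(* Half of the n iterates are spent on the factor I - T, the other half on
   its M-th power. *)
have half p : (n <= p.*2.+1)%N -> forall q : R, 0 <= q ->
    p.+1%:R `^ (- q) <= 2 `^ q * n.+1%:R `^ (- q).
  move=> np q q0; rewrite !powRN -[X in _ <= X / _]invrK -invfM.
  rewrite lef_pV2 ?posrE ?mulr_gt0 ?invr_gt0 ?powR_gt0 ?ltr0n//.
  rewrite mulrC ler_pdivrMr ?powR_gt0// -powRM//.
  apply: ge0_ler_powR; rewrite ?nnegrE ?mulr_ge0//.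
  by rewrite -natrM ler_nat muln2 doubleS ltnS (leq_trans np).
have h1 : (n <= n./2.*2.+1)%N.
  by rewrite -{1}(odd_double_half n) -add1n leq_add2r leq_b1.
have h2 : (n <= (uphalf n).*2.+1)%N.
  rewrite -{1}(odd_double_half n) uphalf_half doubleD -addSn leq_add2r.
  by case: (odd n).
have nE : (n = n./2 + uphalf n)%N.
  by rewrite uphalf_half addnCA addnn odd_double_half.
rewrite {1}nE iterD iterSr.
have -> : iter (uphalf n) T (iter M D (D f)) = iter M D (iter (uphalf n) T (D f)).
  exact: iter_diffC.
apply: le_trans (IH _ _) _.
apply: (@le_trans _ _ (K * (2 `^ M%:R * n.+1%:R `^ (- M%:R)) *
    (C * (2 `^ 1 * n.+1%:R `^ (-1)) * rnorm f))).
  apply: ler_pM; rewrite ?rnorm_ge0 ?mulr_ge0 ?powR_ge0//.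
    by rewrite ler_wpM2l// half.
  apply: le_trans (hD _ _) _; rewrite ler_wpM2r ?rnorm_ge0// ler_wpM2l//.
  by rewrite -[_^-1]powR_inv1// half.
rewrite -(natr1 M) opprD powRDn powRD ?pnatr_eq0 ?implybT//.
by rewrite le_eqVlt; apply/orP; left; apply/eqP; ring.
Qed.

(** Summation by parts. It trades the coefficients, which are only summable
    against the bounded sequence T^j, for their tails, which have size
    j^-theta, against T^j (I - T), which has size 1/j. *)
Lemma frac_power_abel theta N f : 0 < theta -> theta < 1 ->
  f - \sum_(0 <= j < N) of_real k (binom_coef theta j.+1) *: iter j.+1 T f =
  \sum_(0 <= j < N) of_real k (binom_tail theta j) *: iter j T (D f)
  + of_real k (binom_tail theta N) *: iter N T f.
Proof.
move=> t0 t1; elim: N => [|N IH].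
  rewrite !big_geq// binom_tail0 subr0 add0r.
  by rewrite of_real1 scale1r.
rewrite !big_nat_recr//= opprD addrA IH -!addrA; congr (_ + _).
rewrite iter_diffB binom_coef_tail// scalerBr /=.
have -> : of_real k (binom_tail theta N - binom_tail theta N.+1) =
   of_real k (binom_tail theta N) - of_real k (binom_tail theta N.+1).
  by apply/eqP; rewrite eq_sym subr_eq -of_realD subrK.
by rewrite scalerBl opprB [X in _ + X]addrC addrA.
Qed.

Lemma powRN_le1 n q : 0 <= q -> n.+1%:R `^ (- q) <= 1 :> R.
Proof. by move=> q0; rewrite -[leRHS](powRr0 n.+1%:R) ler_powR ?ler1n// oppr_le0. Qed.

(** By summation by parts, the norm of T^n (I - T)^(M + theta) is at most a
    constant times the sum over j of (j+1)^-theta (n+j+1)^(-M-1), and the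
    convolution estimate gives n^(-M-theta). The convergence of the series is a
    hypothesis because V need not be complete. *)
Lemma frac_power_decay theta M : ritt T -> 0 < theta -> theta < 1 ->
  (forall f, cvgn (fun N =>
     \sum_(0 <= j < N) of_real k (binom_coef theta j.+1) *: iter j.+1 T f)) ->
  exists2 K, 0 <= K & forall n f,
    rnorm (iter n T (iter M D (frac_power T theta f))) <=
    K * n.+1%:R `^ (- (M%:R + theta)) * rnorm f.
Proof.
move=> hT t0 t1 hcvg.
have [C [C0 hC hD]] := ritt_rnorm hT.
have [K0 K00 hK0] := iter_diff_decay M C0 hC hD.
have [K1 K10 hK1] := iter_diff_decay M.+1 C0 hC hD.
pose c := (1 - theta)^-1 + theta^-1.
have c0 : 0 <= c by rewrite addr_ge0// invr_ge0 ?subr_ge0 ltW.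
exists (K1 * c) => [|n f]; first exact: mulr_ge0.
pose u N := \sum_(0 <= j < N) of_real k (binom_coef theta j.+1) *: iter j.+1 T f.
have fracE : frac_power T theta f = f - limn u.
  rewrite /frac_power gt_eqF//; congr (f - _).
  apply/cvg_lim => //; rewrite -(cvg_shiftS (fun N => \sum_(1 <= j < N) _)) /=.
  under eq_fun do rewrite big_add1/=.
  exact: hcvg.
have [W hW] := iter_diff_linear n M.
rewrite -hW fracE.
have hWle g : rnorm (W g) <= K0 * rnorm g.
  rewrite hW (le_trans (hK0 _ _))// ler_wpM2r ?rnorm_ge0//.
  by rewrite ler_piMr// powRN_le1.
have hWT j g : W (iter j T g) = iter (n + j) T (iter M D g).
  by rewrite hW iterD -iter_diffC.
have hu N : rnorm (W (f - u N)) <=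
    K1 * c * n.+1%:R `^ (- (M%:R + theta)) * rnorm f
    + K0 * rnorm f * N.+1%:R `^ (- theta).
  rewrite /u frac_power_abel// linearD linear_sum.
  apply: le_trans (ler_rnormD _ _) _; apply: lerD; last first.
    rewrite linearZZ rnormZ_real ?binom_tail_ge0// mulrC.
    apply: ler_pM; rewrite ?rnorm_ge0 ?binom_tail_ge0 ?binom_tail_le//.
    rewrite hWT (le_trans (hK0 _ _))// ler_wpM2r ?rnorm_ge0//.
    by rewrite ler_piMr// powRN_le1.
  apply: le_trans (ler_rnorm_sum _ _) _.
  apply: (@le_trans _ _ (\sum_(0 <= j < N) K1 * n.+1%:R `^ (- M%:R) * rnorm f *
      (j.+1%:R `^ (- theta) * (n + j).+1%:R^-1))).
    apply: ler_sum => j _; rewrite linearZZ rnormZ_real ?binom_tail_ge0//.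
    rewrite mulrCA; apply: ler_pM; rewrite ?rnorm_ge0 ?binom_tail_ge0 ?binom_tail_le//.
    rewrite hWT -iterSr (le_trans (hK1 _ _))// [leRHS]mulrAC ler_wpM2r ?rnorm_ge0//.
    rewrite -(natr1 M) opprD powRDn powR_inv1// -mulrA ler_wpM2l// ler_wpM2r ?invr_ge0//.
    rewrite !powRN lef_pV2 ?posrE ?powR_gt0 ?ltr0n//.
    by apply: ge0_ler_powR; rewrite ?nnegrE// ler_nat ltnS leq_addr.
  rewrite -mulr_sumr opprD powRDn.
  apply: (@le_trans _ _ (K1 * n.+1%:R `^ (- M%:R) * rnorm f * (c * n.+1%:R `^ (- theta)))).
    rewrite ler_wpM2l ?mulr_ge0 ?powR_ge0 ?rnorm_ge0//.
    exact: sum_powR_convolution.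
  by rewrite le_eqVlt; apply/orP; left; apply/eqP; ring.
(* The bound passes from the partial sums u N to their limit. *)
apply/ler_addgt0Pr => eps eps0.
pose q := K0 * (rnorm f + 1) + 1.
have q0 : 0 < q by rewrite ltr_wpDl// mulr_ge0// addr_ge0// rnorm_ge0.
have eq0 : 0 < eps / q by rewrite divr_gt0.
have [n1 hn1] := powR_natS_small t0 eq0.
have [n2 hn2] := cvgn_rnorm (hcvg f) eq0.
pose N := maxn n1 n2.
have -> : f - limn u = (f - u N) - (limn u - u N) by rewrite opprB addrA subrK.
rewrite linearB (le_trans (ler_rnormB _ _))//.
apply: le_trans (lerD (hu N) (hWle _)) _; rewrite -addrA lerD2l.
apply: (@le_trans _ _ (K0 * rnorm f * (eps / q) + K0 * (eps / q))).
  apply: lerD; rewrite ler_wpM2l ?mulr_ge0 ?rnorm_ge0//.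
    exact/hn1/leq_maxl.
  exact/hn2/leq_maxr.
rewrite -mulrDl -[X in _ + X]mulr1 -mulrDr mulrCA ler_piMr ?(ltW eps0)//.
by rewrite ler_pdivrMr// mul1r lerDl.
Qed.

(** For j = 0 this is the decay of the orbit of (I - T)^r f; for j = 1 it says
    that taking differences along this orbit gains one power of n. *)
Lemma real_power_decay r j : ritt T -> 0 <= r ->
  (forall theta f, 0 < theta -> theta < 1 -> cvgn (fun N =>
     \sum_(0 <= j < N) of_real k (binom_coef theta j.+1) *: iter j.+1 T f)) ->
  exists2 K, 0 <= K & forall n f,
    rnorm (iter n T (iter j D (real_power T r f))) <=
    K * n.+1%:R `^ (- (r + j%:R)) * rnorm f.
Proof.
move=> hT r0 hcvg; rewrite /real_power; set m := Num.truncn r.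
have /andP[mr rm] := truncn_itv r0; rewrite -/m in mr rm.
have -> : r + j%:R = (j + m)%:R + (r - m%:R) by rewrite natrD; ring.
suff [K K0 hK] : exists2 K, 0 <= K & forall n f,
    rnorm (iter n T (iter (j + m) D (frac_power T (r - m%:R) f))) <=
    K * n.+1%:R `^ (- ((j + m)%:R + (r - m%:R))) * rnorm f.
  by exists K => // n f; rewrite -[iter j D _]iterD; exact: hK.
have [rm0|rm0] := eqVneq (r - m%:R) 0.
  have [C [C0 hC hD]] := ritt_rnorm hT.
  have [K K0 hK] := iter_diff_decay (j + m) C0 hC hD.
  by exists K => // n f; rewrite rm0 addr0 /frac_power eqxx; exact: hK.
have t0 : 0 < r - m%:R by rewrite lt_neqAle eq_sym rm0 subr_ge0.
have t1 : r - m%:R < 1 by rewrite ltrBlDr nat1r.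
by apply: frac_power_decay => // f; exact: hcvg.
Qed.

End RittDecay.
(** * Absolutely convergent series in L^1 *)

Section RealSeries.
Context d (X : measurableType d) (R : realType) (m : {measure set X -> \bar R}).

(** The pointwise series of absolute values is integrable, hence finite off a
    null set; there the series converges, and the series of absolute values
    dominates its partial sums. *)
Lemma integrable_series (v : nat -> X -> R) (C : R) :
  (forall j, m.-integrable setT (EFin \o v j)) ->
  (forall N, (\sum_(0 <= j < N) \int[m]_x `|v j x|%:E <= C%:E)%E) ->
  exists2 rho : X -> R, m.-integrable setT (EFin \o rho) &
    (\int[m]_x `|\sum_(0 <= j < N) v j x - rho x|%:E)%E @[N --> \oo] --> 0%E.
Proof.
move=> iv hC.
have mv j : measurable_fun setT (v j) by have /measurable_int/measurable_EFinP := iv j.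
have mav j : measurable_fun setT (fun x => `|v j x|%:E).
  by apply/measurable_EFinP; exact: measurableT_comp.
pose G x : \bar R := (\sum_(0 <= j <oo) `|v j x|%:E)%E.
have av0 j x : (0 <= `|v j x|%:E)%E by rewrite lee_fin.
have mG : measurable_fun setT G.
  by apply: (@ge0_emeasurable_sum _ _ _ _ (fun j x => `|v j x|%:E) xpredT).
have G0 x : (0 <= G x)%E by apply: nneseries_ge0.
have iG : m.-integrable setT G.
  apply/integrableP; split => //.
  under eq_integral do rewrite gee0_abs//.
  rewrite /G integral_nneseries//.
  apply: (@le_lt_trans _ _ C%:E); last exact: ltry.
  apply: lime_le; last by apply: nearW => N; exact: hC.
  by apply: is_cvg_nneseries => j _ _; exact: integral_ge0.
pose E := [set x | (G x < +oo)%E].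
have mE : measurable E.
  by rewrite -[E]setTI; exact: emeasurable_fun_infty_o.
(* Partial sums cut off where the absolute series diverges, so that their
   limit exists everywhere and is measurable. *)
pose h N x := (\sum_(0 <= j < N) v j x) * \1_E x.
have hcvg x : cvgn (h ^~ x).
  have [Ex|nEx] := pselect (E x); last first.
    rewrite (_ : h ^~ x = cst 0); first exact: is_cvg_cst.
    by apply/funext => N; rewrite /h indicE memNset// mulr0.
  rewrite (_ : h ^~ x = series (v ^~ x)); last first.
    by apply/funext => N; rewrite /h indicE mem_set// mulr1 /series.
  apply: normed_cvg; apply: nondecreasing_is_cvgn.
    apply/nondecreasing_seqP => n.
    by rewrite -[leRHS]/(\sum_(0 <= j < n.+1) `|v j x|) big_nat_recr//= lerDl.
  exists (fine (G x)) => _ [N _ <-].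
  rewrite -lee_fin fineK ?ge0_fin_numE// -sumEFin.
  by apply: nneseries_lim_ge => j _ _; exact: av0.
pose rho x := limn (h ^~ x).
have mh N : measurable_fun setT (h N).
  apply: measurable_funM; first exact: measurable_sum.
  exact: measurable_indic.
have mrho : measurable_fun setT rho.
  by apply: (measurable_fun_cvg mh) => x _; exact: hcvg.
have Eae : {ae m, forall x, E x}.
  apply: filterS (integrable_ae measurableT iG) => x /(_ I).
  by rewrite ge0_fin_numE.
have [| | | |irho lim0 _] := @dominated_convergence _ X R m setT measurableT
    (fun N x => (\sum_(0 <= j < N) v j x)%:E) (EFin \o rho) G _ _ _ iG _.
- by move=> N; apply/measurable_EFinP; exact: measurable_sum.
- exact/measurable_EFinP.
- apply: filterS Eae => x Ex _; apply: cvg_EFin; first exact: nearW.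
  apply: cvg_trans (hcvg x); apply: near_eq_cvg; apply: nearW => N.
  by rewrite /h indicE mem_set// mulr1.
- apply: aeW => x N _; rewrite abse_EFin.
  apply: (@le_trans _ _ (\sum_(0 <= j < N) `|v j x|%:E)%E).
    by rewrite sumEFin lee_fin ler_norm_sum.
  by apply: nneseries_lim_ge => j _ _; exact: av0.
by exists rho.
Qed.

End RealSeries.

Section L1Series.
Context d (X : measurableType d) (R : realType)
  (m : {measure set X -> \bar R}) (k : scalar_kind).
Local Open Scope quotient_scope.
Implicit Types (f g : L1fun m k).

Lemma piL1B f g : \pi_(L1 m k) (f - g) = \pi_(L1 m k) f - \pi_(L1 m k) g.
Proof. by apply/esym/eqP; rewrite subr_eq piL1D subrK. Qed.

Lemma L1norm_of_pi f : L1norm_of m f = (rnorm (\pi_(L1 m k) f))%:E.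
Proof.
rewrite /rnorm -[`|_|]/(L1norm _) of_real_re fineK ?L1norm_of_fin//.
by apply/esym/eq_L1norm_of/L1reprP.
Qed.

Lemma L1norm_of_repr (f : L1 m k) : L1norm_of m (repr f) = (rnorm f)%:E.
Proof. by rewrite L1norm_of_pi reprK. Qed.

Lemma ler_re_modulus (z : scalar R k) : `|re z| <= modulus z.
Proof.
rewrite modulusE -sqrtr_sqr ler_sqrt ?addr_ge0 ?sqr_ge0//.
by rewrite lerDl sqr_ge0.
Qed.

Lemma ler_im_modulus (z : scalar R k) : `|im z| <= modulus z.
Proof.
rewrite modulusE -sqrtr_sqr ler_sqrt ?addr_ge0 ?sqr_ge0//.
by rewrite lerDr sqr_ge0.
Qed.

Definition of_parts : R -> R -> scalar R k :=
  match k return R -> R -> scalar R k with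
  | RealScalars => fun a _ => a
  | ComplexScalars => fun a b => complex.Complex a b
  end.

Lemma re_of_parts a b : re (of_parts a b) = a.
Proof. by rewrite /of_parts; case: (k). Qed.

Lemma im_of_parts a b : im (of_parts a b) = if k is RealScalars then 0 else b.
Proof. by rewrite /of_parts; case: (k). Qed.

Lemma re_sum N (u : nat -> scalar R k) :
  re (\sum_(0 <= j < N) u j) = \sum_(0 <= j < N) re (u j).
Proof.
elim: N => [|N IH]; first by rewrite !big_geq// re0.
by rewrite !big_nat_recr//= reD IH.
Qed.

Lemma im_sum N (u : nat -> scalar R k) :
  im (\sum_(0 <= j < N) u j) = \sum_(0 <= j < N) im (u j).
Proof.
elim: N => [|N IH]; first by rewrite !big_geq// im0.
by rewrite !big_nat_recr//= imD IH.
Qed.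

Lemma modulus_of_parts_sub (a b : R) (z : scalar R k) :
  modulus (of_parts a b - z) <= `|re z - a| + `|im z - b|.
Proof.
apply: (le_trans (modulus_le _)).
have -> : re (of_parts a b - z) = a - re z.
  by apply/esym/eqP; rewrite subr_eq -reD subrK re_of_parts.
have imB : im (of_parts a b - z) = im (of_parts a b) - im z.
  by apply/esym/eqP; rewrite subr_eq -imD subrK.
rewrite distrC lerD2l imB im_of_parts distrC.
by case: (k) z {imB} => // z; rewrite /= subrr normr0.
Qed.

(** Completeness of L^1 in the form needed for the series of the fractional
    power: real and imaginary parts of representatives are summed separately. *)
Lemma L1_series_cvgn (u : nat -> L1 m k) (C : R) :
  (forall N, \sum_(0 <= j < N) rnorm (u j) <= C) ->
  cvgn (fun N => \sum_(0 <= j < N) u j).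
Proof.
move=> hC.
have hmod (p : scalar R k -> R) : (forall z, `|p z| <= modulus z) ->
    (forall j, m.-integrable setT (fun x => (p (repr (u j) x))%:E)) ->
    exists2 rho : X -> R, m.-integrable setT (EFin \o rho) &
    (\int[m]_x `|\sum_(0 <= j < N) p (repr (u j) x) - rho x|%:E)%E
      @[N --> \oo] --> 0%E.
  move=> hp ip; apply: (integrable_series (C := C) ip) => N.
  apply: le_trans (_ : (\sum_(0 <= j < N) (rnorm (u j))%:E <= C%:E)%E); last first.
    by rewrite sumEFin lee_fin.
  apply: lee_sum => j _; rewrite -L1norm_of_repr; apply: ge0_le_integral => //.
  - apply/measurable_EFinP; apply: measurableT_comp => //.
    by have /measurable_int/measurable_EFinP := ip j.
  - exact: measurable_L1fun.
  - by move=> x _; rewrite lee_fin hp.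
have [rho1 i1 c1] := hmod _ ler_re_modulus (fun j => (L1funP (repr (u j))).1).
have [rho2 i2 c2] := hmod _ ler_im_modulus (fun j => (L1funP (repr (u j))).2).
have FP : (fun x => of_parts (rho1 x) (rho2 x)) \in @L1pred _ _ _ m k.
  apply/asboolP; split.
    by under eq_fun do rewrite re_of_parts.
  under eq_fun do rewrite im_of_parts.
  by case: (k) => //; exact: integrable0.
pose F := MkL1fun FP.
pose S N : L1fun m k := \sum_(0 <= j < N) repr (u j).
have SE N x : S N x = \sum_(0 <= j < N) repr (u j) x.
  elim: N => [|N IH]; first by rewrite /S !big_geq.
  by rewrite /S !big_nat_recr//= -IH.
have piS N : \pi_(L1 m k) (S N) = \sum_(0 <= j < N) u j.
  elim: N => [|N IH].
    by rewrite /S !big_geq// (@pi_zeror _ _ _ _ _ (L1 m k)).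
  by rewrite /S !big_nat_recr//= -piL1D reprK -IH.
pose e1 N := (\int[m]_x `|\sum_(0 <= j < N) re (repr (u j) x) - rho1 x|%:E)%E.
pose e2 N := (\int[m]_x `|\sum_(0 <= j < N) im (repr (u j) x) - rho2 x|%:E)%E.
have e12 N : ((rnorm (\pi_(L1 m k) F - \sum_(0 <= j < N) u j))%:E <= e1 N + e2 N)%E.
  rewrite -piS -piL1B -L1norm_of_pi.
  have mre : measurable_fun setT (fun x =>
      `|\sum_(0 <= j < N) re (repr (u j) x) - rho1 x|%:E).
    apply/measurable_EFinP; apply: measurableT_comp => //.
    apply: measurable_funB; last by have /measurable_int/measurable_EFinP := i1.
    apply: measurable_sum => j.
    by have /measurable_int/measurable_EFinP := (L1funP (repr (u j))).1.
  have mim : measurable_fun setT (fun x =>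
      `|\sum_(0 <= j < N) im (repr (u j) x) - rho2 x|%:E).
    apply/measurable_EFinP; apply: measurableT_comp => //.
    apply: measurable_funB; last by have /measurable_int/measurable_EFinP := i2.
    apply: measurable_sum => j.
    by have /measurable_int/measurable_EFinP := (L1funP (repr (u j))).2.
  rewrite /e1 /e2 -ge0_integralD//; apply: ge0_le_integral => //.
  - by move=> x _; rewrite lee_fin modulus_ge0.
  - exact: measurable_L1fun.
  - exact: emeasurable_funD.
  - move=> x _; rewrite -EFinD lee_fin L1funBE SE -re_sum -im_sum.
    exact: modulus_of_parts_sub.
apply/cvg_ex; exists (\pi_(L1 m k) F); apply: (cvgn_rnormP (fun=> lexx _)).
apply: (@fine_cvg _ _ _ _ (fun N => (rnorm (\pi_(L1 m k) F - \sum_(0 <= j < N) u j))%:E)).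
apply: (@squeeze_cvge _ _ _ _ (cst 0%E) _ (e1 \+ e2)%E).
- by apply: nearW => N /=; rewrite lee_fin rnorm_ge0 e12.
- exact: cvg_cst.
- by rewrite -[X in _ --> X]adde0; apply: cvgeD.
Qed.

End L1Series.
(** * Pointwise majorants *)

Section PointwiseMajorants.
Context {R : realType}.
Implicit Types (s : R) (S : \bar R).

Lemma poweR_inv_le s (u S : \bar R) : 0 < s -> (0 <= u)%E -> (0 <= S)%E ->
  (u `^ s^-1 <= S)%E = (u <= S `^ s)%E.
Proof.
move=> s0 u0 S0.
have pos (x : \bar R) : (0 <= x)%E -> x \in `[0%E, +oo%E].
  by rewrite in_itv/= leey andbT.
have id1 (x : \bar R) : (0 <= x)%E -> ((x `^ s^-1) `^ s = x)%E.
  by move=> x0; rewrite -poweRrM mulVf ?gt_eqF// poweRe1.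
have id2 (x : \bar R) : (0 <= x)%E -> ((x `^ s) `^ s^-1 = x)%E.
  by move=> x0; rewrite -poweRrM divff ?gt_eqF// poweRe1.
apply/idP/idP => h.
  rewrite -(id1 u u0); apply: gt0_ler_poweR; rewrite ?(ltW s0) ?pos ?poweR_ge0//.
rewrite -(id2 S S0); apply: gt0_ler_poweR; rewrite ?invr_ge0 ?(ltW s0) ?pos ?poweR_ge0//.
Qed.

(** Interpolation between a supremum and a sum: the sum of c^(s-1) e is at most
    (sup c)^(s-1) times the sum of e, hence at most S^s. Every exponent s > 1
    is handled by this inequality; with t = c^s and e = c it is the embedding
    of l^1 into l^s. *)
Lemma root_sum_le s S (t c e : nat -> R) a N : 1 <= s ->
  (forall n, (a <= n < N)%N -> [/\ 0 <= t n, 0 <= c n & 0 <= e n]) ->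
  (forall n, (a <= n < N)%N -> t n <= c n `^ (s - 1) * e n) ->
  (forall n, (a <= n < N)%N -> ((c n)%:E <= S)%E) ->
  (\sum_(a <= n < N) (e n)%:E <= S)%E ->
  ((\sum_(a <= n < N) (t n)%:E) `^ s^-1 <= S)%E.
Proof.
move=> s1 pos tce cS eS.
have s0 : 0 < s by rewrite (lt_le_trans ltr01).
have S0 : (0 <= S)%E.
  apply: le_trans eS; rewrite big_nat_cond; apply: sume_ge0 => n /andP[/pos[]].
  by rewrite lee_fin.
have t0 : (0 <= \sum_(a <= n < N) (t n)%:E)%E.
  rewrite big_nat_cond; apply: sume_ge0 => n /andP[/pos[]].
  by rewrite lee_fin.
rewrite poweR_inv_le//; move: S S0 cS eS => [z z0 cz ez| _ _ _|//]; last first.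
  by rewrite poweRyr ?gt_eqF// leey.
move: ez; rewrite poweR_EFin !sumEFin !lee_fin => ez.
apply: (@le_trans _ _ (z `^ (s - 1) * \sum_(a <= n < N) e n)).
  rewrite mulr_sumr big_nat_cond [leRHS]big_nat_cond.
  apply: ler_sum => n; rewrite andbT => an; apply: le_trans (tce n an) _.
  have [_ cn en] := pos _ an; rewrite ler_wpM2r// ge0_ler_powR ?subr_ge0//.
  by rewrite -lee_fin cz.
by rewrite -(mulr_powRB1 _ s0)// mulrC ler_wpM2r ?powR_ge0.
Qed.

Lemma root_series_le s S (u : nat -> \bar R) a : 1 <= s ->
  (forall n, (0 <= u n)%E) ->
  (forall N, ((\sum_(a <= n < N) u n) `^ s^-1 <= S)%E) ->
  ((\sum_(a <= n <oo) u n) `^ s^-1 <= S)%E.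
Proof.
move=> s1 u0 h; have s0 : 0 < s by rewrite (lt_le_trans ltr01).
have S0 : (0 <= S)%E by apply: le_trans (h 0%N); exact: poweR_ge0.
rewrite poweR_inv_le//; last by apply: nneseries_ge0.
apply: lime_le; first exact: is_cvg_nneseries.
by apply: nearW => N; rewrite -poweR_inv_le// sume_ge0.
Qed.

Lemma sum_nat_le_series (u : nat -> \bar R) a p q : (a <= p)%N ->
  (forall n, (0 <= u n)%E) ->
  (\sum_(p <= n < q) u n <= \sum_(a <= n <oo) u n)%E.
Proof.
move=> ap u0; have [pq|qp] := leqP p q; last first.
  by rewrite big_geq ?(ltnW qp)//; exact: nneseries_ge0.
apply: (@le_trans _ _ (\sum_(a <= n < q) u n)%E); last first.
  by apply: nneseries_lim_ge => n _ _; exact: u0.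
by rewrite [leRHS](big_cat_nat (n := p))//= leeDr// sume_ge0.
Qed.

Context {k : scalar_kind}.
Implicit Types (b : nat -> scalar R k) (J : set nat) (p : nat -> nat).

Lemma modulus_distC (x y : scalar R k) : modulus (x - y) = modulus (y - x).
Proof. by rewrite /modulus distrC. Qed.

Lemma modulus_sub_le_sum b i j : (i <= j)%N ->
  modulus (b i - b j) <= \sum_(i <= n < j) modulus (b n - b n.+1).
Proof.
elim: j => [|j IH].
  by rewrite leqn0 => /eqP ->; rewrite subrr modulus0 big_geq.
rewrite leq_eqVlt => /predU1P[->|]; first by rewrite subrr modulus0 big_geq.
rewrite ltnS => ij; rewrite big_nat_recr//=.
have -> : b i - b j.+1 = (b i - b j) + (b j - b j.+1) by rewrite addrA subrK.
by apply: le_trans (ler_modulusD _ _) _; rewrite lerD2r IH.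
Qed.

Lemma increasing_leq p i j : (forall l, (l < j)%N -> (p l < p l.+1)%N) ->
  (i <= j)%N -> (p i <= p j)%N.
Proof.
elim: j => [|j IH] hp; first by rewrite leqn0 => /eqP ->.
rewrite leq_eqVlt => /predU1P[->//|]; rewrite ltnS => ij.
apply: leq_trans (ltnW (hp j (ltnSn _))); apply: IH => // l lj.
exact/hp/ltnW.
Qed.

Lemma sum_block (V : nmodType) (F : nat -> V) p N :
  (forall l, (l < N)%N -> (p l < p l.+1)%N) ->
  \sum_(0 <= j < N) \sum_(p j <= n < p j.+1) F n = \sum_(p 0%N <= n < p N) F n.
Proof.
elim: N => [|N IH] hp; first by rewrite !big_geq.
rewrite big_nat_recr//= IH; last by move=> l lN; apply: hp; rewrite ltnW.
rewrite -big_cat_nat//=; last exact/ltnW/hp.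
by apply: (@increasing_leq p 0 N) => // l lN; apply: hp; rewrite ltnW.
Qed.

(** All s-variations are at most the 1-variation, because consecutive blocks
    of increments of an increasing sequence are disjoint. *)
Lemma variation_norm_le s S J b : 1 <= s ->
  (forall i j, J i -> J j -> (i <= j)%N ->
     (\sum_(i <= n < j) (modulus (b n - b n.+1))%:E <= S)%E) ->
  (variation_norm s J b <= S)%E.
Proof.
move=> s1 hS.
have fin N p : (forall j, (j <= N)%N -> J (p j)) ->
    (forall j, (j < N)%N -> (p j < p j.+1)%N) ->
    ((\sum_(0 <= j < N) (modulus (b (p j) - b (p j.+1)) `^ s)%:E) `^ s^-1 <= S)%E.
  move=> pJ pN; pose c j := modulus (b (p j) - b (p j.+1)).
  have c0 j : 0 <= c j by exact: modulus_ge0.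
  have tot : (\sum_(0 <= j < N) (c j)%:E <= S)%E.
    apply: le_trans (_ : (\sum_(p 0%N <= n < p N) (modulus (b n - b n.+1))%:E <= S)%E).
      rewrite !sumEFin lee_fin -sum_block// big_nat_cond [leRHS]big_nat_cond.
      apply: ler_sum => j /andP[/andP[_ jN] _].
      exact/modulus_sub_le_sum/ltnW/pN.
    by apply: hS; [exact: pJ|exact: pJ|exact: increasing_leq].
  apply: (root_sum_le (c := c) (e := c)) => //.
  - by move=> n _; split => //; exact: powR_ge0.
  - by move=> n _; rewrite mulrC mulr_powRB1// (lt_le_trans ltr01).
  - move=> n /andP[_ nN]; apply: le_trans tot.
    rewrite (big_cat_nat (n := n.+1))//= big_nat_recr//=.
    rewrite addeAC leeDr// adde_ge0// sume_ge0// => *; exact: c0.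
apply: ge_ereal_sup => v [[N [p [pJ pN ->]]]|[p [pJ pN ->]]]; first exact: fin.
apply: root_series_le => // [n|N]; first by rewrite lee_fin powR_ge0.
exact: fin.
Qed.

Lemma bigmax_modulus_le b i j l : (forall n, (i <= n < j)%N -> (n <= l)%N) ->
  \big[Num.max/0]_(i <= n < j) modulus (b n - b i) <=
  \sum_(i <= n < l) modulus (b n - b n.+1).
Proof.
move=> hl; rewrite big_nat_cond.
apply: (big_ind (fun v => v <= _)) => [|x y|n /andP[/andP[il nj] _]].
- by apply: sumr_ge0 => n _; exact: modulus_ge0.
- by move=> hx hy; rewrite ge_max hx hy.
rewrite modulus_distC; apply: (le_trans (modulus_sub_le_sum b il)).
rewrite [leRHS](big_cat_nat (n := n))//=; last by apply: hl; rewrite il.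
by rewrite lerDl sumr_ge0// => *; exact: modulus_ge0.
Qed.

Lemma bigmax_ge0 (u : nat -> R) i j : 0 <= \big[Num.max/0]_(i <= n < j) u n.
Proof.
by elim: (index_iota i j) => [|x l IH]; rewrite ?big_nil// big_cons le_max IH orbT.
Qed.

Lemma oscillation_norm_le s S p b : 1 <= s -> increasing_positive p ->
  (\sum_(1 <= n <oo) (modulus (b n - b n.+1))%:E <= S)%E ->
  (oscillation_norm s p b <= S)%E.
Proof.
move=> s1 [p0 pS] hS.
apply: root_series_le => // [n|N]; first by rewrite lee_fin powR_ge0.
pose c i := \big[Num.max/0]_(p i <= n < (p i.+1).+1) modulus (b n - b (p i)).
have c0 j : 0 <= c j by exact: bigmax_ge0.
have tot : (\sum_(0 <= j < N) (c j)%:E <= S)%E.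
  apply: le_trans hS.
  apply: le_trans (sum_nat_le_series (p N) (p0 0%N) _); last first.
    by move=> n; rewrite lee_fin modulus_ge0.
  rewrite !sumEFin lee_fin -(@sum_block _ _ p N (fun l _ => pS l)).
  by apply: ler_sum => j _; apply: bigmax_modulus_le => n /andP[].
apply: (root_sum_le (c := c) (e := c)) => //.
- by move=> n _; split => //; exact: powR_ge0.
- by move=> n _; rewrite mulrC mulr_powRB1// (lt_le_trans ltr01).
- move=> n /andP[_ nN]; apply: le_trans tot.
  rewrite (big_cat_nat (n := n.+1))//= big_nat_recr//=.
  rewrite addeAC leeDr// adde_ge0// sume_ge0// => *; exact: c0.
Qed.

End PointwiseMajorants.

(** * Measurability *)

Section Measurability.
Context d (X : measurableType d) (R : realType)
  (m : {measure set X -> \bar R}) (k : scalar_kind).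
Implicit Types (b : nat -> L1fun m k) (h : nat -> X -> \bar R) (s : R).

Lemma measurable_L1fun_modulus (f : L1fun m k) :
  measurable_fun setT (fun x => modulus (f x)).
Proof. exact/measurable_modulus/L1funP. Qed.

Lemma measurable_series_from a h :
  (forall n, measurable_fun setT (h n)) -> (forall n x, (0 <= h n x)%E) ->
  measurable_fun setT (fun x => (\sum_(a <= n <oo) h n x)%E).
Proof.
move=> mh h0; under eq_fun do rewrite -nneseries_addn//.
by apply: (@ge0_emeasurable_sum _ _ _ _ (fun n => h (n + a)%N) xpredT).
Qed.

Lemma measurable_root_series a s h :
  (forall n, measurable_fun setT (h n)) -> (forall n x, (0 <= h n x)%E) ->
  measurable_fun setT (fun x => ((\sum_(a <= n <oo) h n x) `^ s^-1)%E).
Proof.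
move=> mh h0; apply: (measurableT_comp (measurable_poweR s^-1)).
exact: measurable_series_from.
Qed.

Lemma measurable_bigmax (u : nat -> X -> R) i j :
  (forall n, measurable_fun setT (u n)) ->
  measurable_fun setT (fun x => \big[Num.max/0]_(i <= n < j) u n x).
Proof.
move=> mu; elim: (index_iota i j) => [|l t IH] /=.
  by under eq_fun do rewrite big_nil; exact: measurable_cst.
under eq_fun do rewrite big_cons.
exact: measurable_maxr.
Qed.

Lemma measurable_sup_ge a h : (forall n, measurable_fun setT (h n)) ->
  measurable_fun setT
    (fun x => ereal_sup [set h n x | n in [set n | (a <= n)%N]]).
Proof. by move=> mh; exact: (measurable_fun_esups mh a). Qed.

Lemma variation_norm_ge0 s (J : set nat) (a : nat -> scalar R k) p0 :
  1 <= s -> J p0 -> (0 <= variation_norm s J a)%E.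
Proof.
move=> s1 Jp0; apply: ereal_sup_ubound; left; exists 0%N, (fun=> p0); split => //.
by rewrite big_geq// poweR0r// invr_eq0 gt_eqF// (lt_le_trans ltr01).
Qed.

(** The finite sequences of naturals are numbered by pickle; the codes of
    sequences that are not increasing in J contribute 0. *)
Definition coded_variation s (J : set nat) (a : nat -> scalar R k) i : \bar R :=
  if unpickle i is Some l then
    if `[< (forall j, (j <= (size l).-1)%N -> J (nth 0 l j)%N) /\
           (forall j, (j < (size l).-1)%N -> (nth 0 l j < nth 0 l j.+1)%N) >]
    then ((\sum_(0 <= j < (size l).-1)
       (modulus (a (nth 0 l j)%N - a (nth 0 l j.+1)%N) `^ s)%:E) `^ s^-1)%E
    else 0%E
  else 0%E.

(** Measurability rests on this: an infinite sum is the limit of its partial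
    sums, so that the countably many finite sequences suffice. *)
Lemma variation_norm_countable s (J : set nat) (a : nat -> scalar R k) p0 :
  1 <= s -> J p0 -> variation_norm s J a =
  ereal_sup [set coded_variation s J a i | i in [set i | (0 <= i)%N]].
Proof.
move=> s1 Jp0; set Sup := ereal_sup [set _ | _ in _].
have s0 : 0 < s by rewrite (lt_le_trans ltr01).
have fin N p : (forall j, (j <= N)%N -> J (p j)) ->
    (forall j, (j < N)%N -> (p j < p j.+1)%N) ->
    ((\sum_(0 <= j < N) (modulus (a (p j) - a (p j.+1)) `^ s)%:E) `^ s^-1 <= Sup)%E.
  move=> pJ pN; apply: ereal_sup_ubound; exists (pickle (mkseq p N.+1)) => //.
  have nthp j : (j <= N)%N -> nth 0%N (mkseq p N.+1) j = p j.
    by move=> jN; rewrite nth_mkseq.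
  rewrite /coded_variation pickleK size_mkseq -[N.+1.-1]/N.
  case: asboolP => [_|[]]; last first.
    split=> j jN; first by rewrite nthp//; exact: pJ.
    by rewrite !nthp ?(ltnW jN)//; exact: pN.
  congr (_ `^ _)%E; rewrite big_nat_cond [RHS]big_nat_cond.
  by apply: eq_bigr => j /andP[/andP[_ jN] _]; rewrite !nthp// ltnW.
apply/eqP; rewrite eq_le; apply/andP; split.
  apply: ge_ereal_sup => v [[N [p [pJ pN ->]]]|[p [pJ pN ->]]]; first exact: fin.
  apply: root_series_le => // [n|N]; first by rewrite lee_fin powR_ge0.
  exact: fin.
have V0 : (0 <= variation_norm s J a)%E by exact: variation_norm_ge0 Jp0.
apply: ge_ereal_sup => v [i _ <-]; rewrite /coded_variation; case: unpickle => [l|//].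
case: asboolP => [[lJ lN]|//]; apply: ereal_sup_ubound; left.
by exists (size l).-1, (nth 0%N l).
Qed.

Lemma measurable_variation_norm s (J : set nat) b p0 : 1 <= s -> J p0 ->
  measurable_fun setT (fun x => variation_norm s J (fun n => b n x)).
Proof.
move=> s1 Jp0; under eq_fun do rewrite (variation_norm_countable _ s1 Jp0).
apply: (measurable_sup_ge 0
  (h := fun i x => coded_variation s J (fun n => b n x) i)) => i.
rewrite /coded_variation; case: unpickle => [l|]; last exact: measurable_cst.
case: asboolP => _; last exact: measurable_cst.
apply: (measurableT_comp (measurable_poweR s^-1)).
apply: emeasurable_sum => j; apply/measurable_EFinP.
apply: (measurableT_comp (measurable_powR s)).
exact: (measurable_L1fun_modulus (b (nth 0%N l j) - b (nth 0%N l j.+1))).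
Qed.

Lemma measurable_oscillation_norm s p b :
  measurable_fun setT (fun x => oscillation_norm s p (fun n => b n x)).
Proof.
apply: measurable_root_series => [i|i x]; last by rewrite lee_fin powR_ge0.
apply/measurable_EFinP; apply: (measurableT_comp (measurable_powR s)).
apply: measurable_bigmax => n.
exact: (measurable_L1fun_modulus (b n - b (p i))).
Qed.

(** V itself must be measurable, but all the estimates are made on G. *)
Lemma bounded_in_L1_majorant (V G : L1 m k -> X -> \bar R) (C : R) :
  (forall f, measurable_fun setT (V f)) ->
  (forall f, measurable_fun setT (G f)) ->
  (forall f x, (0 <= V f x)%E) -> (forall f x, (V f x <= G f x)%E) ->
  (forall f, (\int[m]_x G f x <= (C * rnorm f)%:E)%E) -> bounded_in_L1 V.
Proof.
move=> mV mG V0 VG iG; exists C => f; split => //.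
rewrite L1norm_of_repr -EFinM; apply: le_trans (iG f).
by apply: ge0_le_integral.
Qed.

End Measurability.

(** * Sequences of integrable functions with polynomially decaying norms *)

Section DecayingSequences.
Context d (X : measurableType d) (R : realType)
  (m : {measure set X -> \bar R}) (k : scalar_kind).
Local Open Scope quotient_scope.
Implicit Types (f g : L1fun m k) (a b : nat -> L1fun m k) (r s K : R).

(** The L^1 norm of a function through its class, which makes the norm
    inequalities of L^1 available for functions. *)
Definition nu f : R := rnorm (\pi_(L1 m k) f).

Lemma integral_modulus f : (\int[m]_x (modulus (f x))%:E)%E = (nu f)%:E.
Proof. exact: L1norm_of_pi. Qed.

Lemma nu_ge0 f : 0 <= nu f. Proof. exact: rnorm_ge0. Qed.

Lemma ler_nuB f g : nu (f - g) <= nu f + nu g.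
Proof. by rewrite /nu piL1B ler_rnormB. Qed.

Lemma nuZ_real (c : R) f : 0 <= c -> nu (of_real k c *: f) = c * nu f.
Proof.
move=> c0; rewrite /nu -(rnormZ_real _ c0).
by congr rnorm; rewrite -L1scaleE.
Qed.

(** All that is used of the orbit of (I - T)^r f: the size of its terms, and one
    more power of n for its increments. The index starts at 1, as in the
    square function and in the variation norms. *)
Definition decays r K a := forall n,
  nu (a n.+1) <= K * n.+1%:R `^ (- r) /\
  nu (a n.+1 - a n.+2) <= K * n.+1%:R `^ (- (r + 1)).

Lemma integral_series_le (h : nat -> X -> R) K eps : 0 < eps -> 0 <= K ->
  (forall n, measurable_fun setT (h n)) -> (forall n x, 0 <= h n x) ->
  (forall n, (\int[m]_x (h n.+1 x)%:E <= (K * n.+1%:R `^ (- 1 - eps))%:E)%E) ->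
  (\int[m]_x (\sum_(1 <= n <oo) (h n x)%:E) <= (K * (1 + eps^-1))%:E)%E.
Proof.
move=> e0 K0 mh h0 hK.
have h0' n x : (0 <= (h n x)%:E)%E by rewrite lee_fin.
have mh' n : measurable_fun setT (fun x => (h n x)%:E) by exact/measurable_EFinP.
under eq_integral do rewrite -(nneseries_addn _ (fun n => h0' n _)).
under eq_integral do under eq_eseriesr do rewrite addn1.
rewrite integral_nneseries//.
apply: lime_le; first by apply: is_cvg_nneseries => n _ _; exact: integral_ge0.
apply: nearW => N.
apply: (@le_trans _ _ (\sum_(0 <= n < N) (K * n.+1%:R `^ (- 1 - eps))%:E)%E).
  by apply: lee_sum => n _.
by rewrite sumEFin lee_fin -mulr_sumr ler_wpM2l// sum_powR_le.
Qed.

Definition weighted_series delta a x : \bar R :=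
  (\sum_(1 <= n <oo) (n%:R `^ delta * modulus (a n x))%:E)%E.

Lemma weighted_series_ge0 delta a x : (0 <= weighted_series delta a x)%E.
Proof.
apply: nneseries_ge0 => n _ _.
by rewrite lee_fin mulr_ge0 ?powR_ge0 ?modulus_ge0.
Qed.

Lemma measurable_weighted_series delta a :
  measurable_fun setT (weighted_series delta a).
Proof.
apply: measurable_series_from => [n|n x]; last first.
  by rewrite lee_fin mulr_ge0 ?powR_ge0 ?modulus_ge0.
apply/measurable_EFinP; apply: measurable_funM; first exact: measurable_cst.
exact: measurable_L1fun_modulus.
Qed.

Lemma integral_scaled_modulus (c : R) f : 0 <= c ->
  (\int[m]_x (c * modulus (f x))%:E = (c * nu f)%:E)%E.
Proof.
move=> c0; rewrite -nuZ_real// -integral_modulus; apply: eq_integral => x _.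
by rewrite L1funZE modulusM modulus_of_real ger0_norm.
Qed.

Lemma integral_weighted_series r delta K a : decays r K a -> 0 <= K ->
  delta + 1 < r ->
  (\int[m]_x weighted_series delta a x <= (K * (1 + (r - delta - 1)^-1))%:E)%E.
Proof.
move=> aK K0 dr.
apply: (integral_series_le (h := fun n x => n%:R `^ delta * modulus (a n x))) => //.
- lra.
- move=> n; apply: measurable_funM; first exact: measurable_cst.
  exact: measurable_L1fun_modulus.
- by move=> n x; rewrite mulr_ge0 ?powR_ge0 ?modulus_ge0.
move=> n; rewrite integral_scaled_modulus ?powR_ge0// lee_fin.
apply: (@le_trans _ _ (n.+1%:R `^ delta * (K * n.+1%:R `^ (- r)))).
  by rewrite ler_wpM2l ?powR_ge0// (aK n).1.
by rewrite mulrCA -powRDn (_ : delta + - r = - 1 - (r - delta - 1))//; ring.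
Qed.

Definition weigh beta a n : L1fun m k := of_real k (n%:R `^ beta) *: a n.

Lemma modulus_weigh beta a n x :
  modulus (weigh beta a n x) = n%:R `^ beta * modulus (a n x).
Proof. by rewrite L1funZE modulusM modulus_of_real ger0_norm// powR_ge0. Qed.

(** The first term is added to the variation of n^beta a_n so that the result
    also dominates the sequence uniformly. *)
Definition total_variation beta a x : \bar R :=
  ((modulus (weigh beta a 1 x))%:E +
   \sum_(1 <= n <oo) (modulus (weigh beta a n x - weigh beta a n.+1 x))%:E)%E.

Lemma measurable_total_variation beta a :
  measurable_fun setT (total_variation beta a).
Proof.
apply: emeasurable_funD.
  exact/measurable_EFinP/measurable_L1fun_modulus.
apply: measurable_series_from => [n|n x]; last by rewrite lee_fin modulus_ge0.
exact/measurable_EFinP/(measurable_L1fun_modulus (weigh beta a n - weigh beta a n.+1)).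
Qed.

Lemma variation_series_le beta a x :
  (\sum_(1 <= n <oo) (modulus (weigh beta a n x - weigh beta a n.+1 x))%:E
   <= total_variation beta a x)%E.
Proof. by rewrite leeDr// lee_fin modulus_ge0. Qed.

Lemma total_variation_ge0 beta a x : (0 <= total_variation beta a x)%E.
Proof.
rewrite adde_ge0 ?lee_fin ?modulus_ge0//.
by apply: nneseries_ge0 => n _ _; rewrite lee_fin modulus_ge0.
Qed.

Lemma weigh_le_total_variation beta a n x : (0 < n)%N ->
  ((n%:R `^ beta * modulus (a n x))%:E <= total_variation beta a x)%E.
Proof.
move=> n0; rewrite -modulus_weigh.
pose b i := weigh beta a i x.
apply: (@le_trans _ _ ((modulus (b 1%N))%:E + (modulus (b 1%N - b n))%:E)%E).
  rewrite -EFinD lee_fin modulus_distC (_ : weigh beta a n x = b 1%N + (b n - b 1%N)).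
    exact: ler_modulusD.
  by rewrite addrCA subrr addr0.
rewrite leeD2l//.
apply: (@le_trans _ _ (\sum_(1 <= i < n) (modulus (b i - b i.+1))%:E)%E).
  by rewrite sumEFin lee_fin modulus_sub_le_sum.
by apply: sum_nat_le_series => // i; rewrite lee_fin modulus_ge0.
Qed.

(** The product rule for differences: one summand carries the increment of
    a_n, the other the increment of n^beta; both have size n^(beta-1-r). *)
Lemma nu_weigh_diff r beta K a n : decays r K a -> 0 <= K ->
  0 <= beta -> beta < r ->
  nu (weigh beta a n.+1 - weigh beta a n.+2) <=
  K * (1 + 2 * beta) * n.+1%:R `^ (- 1 - (r - beta)).
Proof.
move=> aK K0 b0 br.
pose c := n.+2%:R `^ beta - n.+1%:R `^ beta : R.
have c0 : 0 <= c.
  by rewrite subr_ge0 ge0_ler_powR ?nnegrE// ler_nat.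
have -> : weigh beta a n.+1 - weigh beta a n.+2 =
    of_real k (n.+1%:R `^ beta) *: (a n.+1 - a n.+2) - of_real k c *: a n.+2.
  have cE : of_real k (n.+2%:R `^ beta) = of_real k c + of_real k (n.+1%:R `^ beta).
    by rewrite -of_realD subrK.
  by rewrite /weigh cE scalerBr scalerDl opprD addrA addrAC.
apply: le_trans (ler_nuB _ _) _; rewrite !nuZ_real ?powR_ge0//.
rewrite mulrDr mulr1 mulrDl; apply: lerD.
  apply: (@le_trans _ _ (n.+1%:R `^ beta * (K * n.+1%:R `^ (- (r + 1))))).
    by rewrite ler_wpM2l ?powR_ge0// (aK n).2.
  by rewrite mulrCA -powRDn (_ : beta + - (r + 1) = - 1 - (r - beta))//; ring.
apply: (@le_trans _ _ (2 * beta * n.+2%:R `^ (beta - 1) * (K * n.+2%:R `^ (- r)))).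
  by apply: ler_pM; rewrite ?nu_ge0 ?powR_succ_sub ?(aK n.+1).1.
have -> : 2 * beta * n.+2%:R `^ (beta - 1) * (K * n.+2%:R `^ (- r)) =
    K * (2 * beta) * n.+2%:R `^ (- 1 - (r - beta)) :> R.
  rewrite (_ : - 1 - (r - beta) = (beta - 1) + - r); last by ring.
  by rewrite (powRDn _ (beta - 1)); ring.
rewrite ler_wpM2l ?mulr_ge0// -opprD !powRN lef_pV2 ?posrE ?powR_gt0 ?ltr0n//.
by apply: ge0_ler_powR; rewrite ?nnegrE ?ler_nat//; lra.
Qed.

Lemma integral_total_variation r beta K a : decays r K a -> 0 <= K ->
  0 <= beta -> beta < r ->
  (\int[m]_x total_variation beta a x <=
   (K * (1 + (1 + 2 * beta) * (1 + (r - beta)^-1)))%:E)%E.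
Proof.
move=> aK K0 b0 br; rewrite /total_variation ge0_integralD//; last 4 first.
- by move=> x _; rewrite lee_fin modulus_ge0.
- exact/measurable_EFinP/measurable_L1fun_modulus.
- by move=> x _; apply: nneseries_ge0 => n _ _; rewrite lee_fin modulus_ge0.
- apply: measurable_series_from => [n|n x]; last by rewrite lee_fin modulus_ge0.
  exact/measurable_EFinP/(measurable_L1fun_modulus (weigh beta a n - weigh beta a n.+1)).
rewrite mulrDr mulr1 EFinD; apply: leeD.
  rewrite integral_modulus lee_fin nuZ_real ?powR_ge0// powR1 mul1r.
  by have := (aK 0%N).1; rewrite powR1 mulr1.
rewrite mulrA.
apply: (integral_series_le (h := fun n x =>
    modulus (weigh beta a n x - weigh beta a n.+1 x))) => //.
- by rewrite subr_gt0.
- by rewrite mulr_ge0// addr_ge0// mulr_ge0.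
- move=> n; exact: (measurable_L1fun_modulus (weigh beta a n - weigh beta a n.+1)).
- by move=> n x; exact: modulus_ge0.
move=> n; rewrite (integral_modulus (weigh beta a n.+1 - weigh beta a n.+2)).
by rewrite lee_fin; exact: nu_weigh_diff.
Qed.

End DecayingSequences.

(** * Square functions and sums over blocks *)

Section Interpolation.
Context d (X : measurableType d) (R : realType)
  (m : {measure set X -> \bar R}) (k : scalar_kind).
Implicit Types (a : nat -> L1fun m k) (r s : R) (p : nat -> nat).

Lemma root_series_mono s (u v : nat -> \bar R) i0 : 1 <= s ->
  (forall i, (0 <= u i)%E) -> (forall i, (u i <= v i)%E) ->
  ((\sum_(i0 <= i <oo) u i) `^ s^-1 <= (\sum_(i0 <= i <oo) v i) `^ s^-1)%E.
Proof.
move=> s1 u0 uv; have s0 : 0 < s by rewrite (lt_le_trans ltr01).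
have v0 i : (0 <= v i)%E by exact: le_trans (uv i).
apply: gt0_ler_poweR; rewrite ?invr_ge0 ?(ltW s0)//.
- by rewrite in_itv/= leey andbT nneseries_ge0.
- by rewrite in_itv/= leey andbT nneseries_ge0.
by apply: lee_nneseries.
Qed.

(** n^alpha |a_n|^s = (n^gamma |a_n|)^(s-1) (n^delta |a_n|) with
    delta = alpha - gamma (s-1): the first factor is controlled uniformly if
    gamma < r and the second one in sum if delta + 1 < r. When gamma tends
    to r the two conditions become alpha + 1 < s r. *)
Lemma root_weighted_series_le alpha r s : 0 < r -> 1 <= s -> alpha + 1 < s * r ->
  exists gamma delta, [/\ 0 <= gamma, gamma < r, delta + 1 < r &
    forall a x,
      ((\sum_(1 <= n <oo) (n%:R `^ alpha * modulus (a n x) `^ s)%:E) `^ s^-1 <=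
       total_variation gamma a x + weighted_series delta a x)%E].
Proof.
move=> r0 s1 asr; have s0 : 0 < s by rewrite (lt_le_trans ltr01).
(* For s = 1 the quotient is 0 by convention, which is the right value. *)
pose q := (alpha + 1 - r) / (s - 1).
have qr : q < r /\ forall g, q < g -> alpha - g * (s - 1) + 1 < r.
  have [s1e|s1n] := eqVneq s 1.
    rewrite /q s1e subrr invr0 mulr0; split => // g _.
    by rewrite mulr0; move: asr; rewrite s1e mul1r subr0.
  have s10 : 0 < s - 1 by rewrite subr_gt0 lt_neqAle eq_sym s1n.
  split=> [|g]; rewrite /q ltr_pdivrMr//; last by lra.
  by move: asr; lra.
pose M := Num.max 0 q.
have Mr : M < r by rewrite /M gt_max r0 qr.1.
have M0 : 0 <= M by rewrite /M le_max lexx.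
have Mq : q <= M by rewrite /M le_max lexx orbT.
pose g := (M + r) / 2.
have gM : M < g by rewrite /g; lra.
exists g, (alpha - g * (s - 1)); split.
- by lra.
- by rewrite /g; lra.
- by apply: qr.2; lra.
move=> a x.
have TV0 := total_variation_ge0 g a x.
have WS0 := weighted_series_ge0 (alpha - g * (s - 1)) a x.
apply: root_series_le => // [n|N]; first by rewrite lee_fin mulr_ge0 ?powR_ge0.
apply: (root_sum_le (c := fun n => n%:R `^ g * modulus (a n x))
   (e := fun n => n%:R `^ (alpha - g * (s - 1)) * modulus (a n x))) => //.
- by move=> n _; rewrite !mulr_ge0 ?powR_ge0 ?modulus_ge0.
- case=> [//|n] _; rewrite powRM ?powR_ge0 ?modulus_ge0// -powRrM.
  rewrite -[modulus _ `^ s](mulr_powRB1 _ s0) ?modulus_ge0//.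
  rewrite (_ : alpha = g * (s - 1) + (alpha - g * (s - 1))); last by ring.
  rewrite [X in X * _ <= _]powRDn.
  rewrite (_ : g * (s - 1) + (alpha - g * (s - 1)) = alpha); last by ring.
  by rewrite le_eqVlt; apply/orP; left; apply/eqP; ring.
- move=> n /andP[n0 _]; apply: le_trans (weigh_le_total_variation g a x n0) _.
  by rewrite leeDl.
apply: le_trans (_ : (weighted_series (alpha - g * (s - 1)) a x <= _)%E).
  apply: sum_nat_le_series => // n.
  by rewrite lee_fin mulr_ge0 ?powR_ge0 ?modulus_ge0.
by rewrite leeDr.
Qed.

Definition block_sum p a i x : R := \sum_(p i <= n < p i.+1) modulus (a n x).

Lemma block_sum_ge0 p a i x : 0 <= block_sum p a i x.
Proof. by apply: sumr_ge0 => *; exact: modulus_ge0. Qed.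

(** The same interpolation for the block sums D_i; a_n will be the increment
    T^n f - T^(n+1) f, which decays with r = 1. If |a_n| <= n^-rho M, then
    D_i <= (p_(i+1) - p_i) p_i^-rho M, which is of order p_i^(alpha - rho) M;
    and since all n in the i-th block are comparable with p_i, the sum of
    p_i^eta D_i is at most a multiple of the sum of n^eta |a_n|. The two estimates
    can be combined when beta s / (s - 1) < rho - alpha < 1 - alpha, which is
    possible precisely under the assumption on s. *)
Lemma root_block_sum_le p (alpha beta c s : R) : increasing_positive p ->
  0 < alpha -> 0 <= beta -> beta < 1 - alpha -> 0 < c -> 1 <= s ->
  (forall i, (p i.+1)%:R - (p i)%:R <= c * (p i)%:R `^ alpha) ->
  (1 - alpha) / (1 - alpha - beta) < s ->
  exists rho eta C, [/\ 0 <= rho, rho < 1, eta < 0, 0 <= C & forall a x,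
    ((\sum_(0 <= i <oo) ((p i)%:R `^ (beta * s) * block_sum p a i x `^ s)%:E)
       `^ s^-1 <=
     c%:E * total_variation rho a x + C%:E * weighted_series eta a x)%E].
Proof.
move=> [p0 pS] al0 b0 bal c0 s1 gap sab.
have s0 : 0 < s by rewrite (lt_le_trans ltr01).
have ab0 : 0 < 1 - alpha - beta by lra.
have al1 : alpha < 1 by lra.
have s1' : 1 < s.
  apply: le_lt_trans sab; rewrite ler_pdivlMr// mul1r; lra.
have s10 : 0 < s - 1 by lra.
move: sab; rewrite ltr_pdivrMr// => sab.
pose q := beta * s / (s - 1).
have q0 : 0 <= q by rewrite /q divr_ge0 ?mulr_ge0 ?(ltW s0) ?(ltW s10).
have q1 : q < 1 - alpha by rewrite /q ltr_pdivrMr//; lra.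
pose g := (q + (1 - alpha)) / 2.
have qg : q < g by rewrite /g; lra.
have g1 : g < 1 - alpha by rewrite /g; lra.
pose eta := beta * s - g * (s - 1).
have eta0 : eta < 0.
  by move: qg; rewrite /q ltr_pdivrMr// /eta; lra.
pose rho := g + alpha.
pose C := (1 + c) `^ (- eta).
exists rho, eta, C; split => //.
- by rewrite /rho; lra.
- by rewrite /rho; lra.
- exact: powR_ge0.
move=> a x; pose D i := block_sum p a i x.
pose F n := n%:R `^ eta * modulus (a n x).
have D0 i : 0 <= D i by exact: block_sum_ge0.
have F0 n : (0 <= (F n)%:E)%E by rewrite lee_fin mulr_ge0 ?powR_ge0 ?modulus_ge0.
have TV0 := total_variation_ge0 rho a x.
have WS0 := weighted_series_ge0 eta a x.
have pr0 i : 0 < (p i)%:R :> R by rewrite ltr0n.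
apply: root_series_le => // [n|N]; first by rewrite lee_fin mulr_ge0 ?powR_ge0.
apply: (root_sum_le (c := fun i => (p i)%:R `^ g * D i)
   (e := fun i => (p i)%:R `^ eta * D i)) => //.
- by move=> n _; rewrite !mulr_ge0 ?powR_ge0.
- move=> i _; rewrite powRM ?powR_ge0// -powRrM -(mulr_powRB1 (D0 i) s0).
  have -> : beta * s = g * (s - 1) + eta by rewrite /eta; ring.
  rewrite [(p i)%:R `^ (_ + _)]powRD ?(gt_eqF (pr0 i)) ?implybT//.
  by rewrite le_eqVlt; apply/orP; left; apply/eqP; ring.
- move=> i _; apply: (@le_trans _ _ (c%:E * total_variation rho a x)%E); last first.
    by rewrite leeDl// mule_ge0// lee_fin powR_ge0.
  have TVn n : (p i <= n)%N ->
      ((n%:R `^ rho * modulus (a n x))%:E <= total_variation rho a x)%E.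
    by move=> pn; apply: weigh_le_total_variation; exact: leq_trans pn.
  case: (total_variation rho a x) TV0 TVn => [z z0 TVn|_ _|//]; last first.
    by rewrite gt0_muley ?lte_fin// leey.
  rewrite -EFinM lee_fin.
  apply: (@le_trans _ _ ((p i)%:R `^ g *
      \sum_(p i <= n < p i.+1) (p i)%:R `^ (- rho) * z)).
    rewrite ler_wpM2l ?powR_ge0// /D /block_sum big_nat_cond [leRHS]big_nat_cond.
    apply: ler_sum => n /andP[/andP[pn _] _].
    rewrite powRN mulrC ler_pdivlMr ?powR_gt0// mulrC.
    apply: le_trans (_ : n%:R `^ rho * modulus (a n x) <= z); last first.
      by rewrite -lee_fin TVn.
    rewrite ler_wpM2r ?modulus_ge0// ge0_ler_powR ?nnegrE// ?ler_nat//.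
    by rewrite /rho; lra.
  rewrite big_const_nat iter_addr_0 -[_ *+ (p i.+1 - p i)%N]mulr_natr.
  rewrite natrB ?(ltnW (pS i))//.
  apply: (@le_trans _ _ ((p i)%:R `^ g *
      ((p i)%:R `^ (- rho) * z * (c * (p i)%:R `^ alpha)))).
    by rewrite ler_wpM2l ?powR_ge0// ler_wpM2l ?mulr_ge0 ?powR_ge0.
  have pE : (p i)%:R `^ g * (p i)%:R `^ (- rho) * (p i)%:R `^ alpha = 1 :> R.
    rewrite -!powRD ?(gt_eqF (pr0 i)) ?implybT// (_ : g + - rho + alpha = 0) ?powRr0//.
    by rewrite /rho; ring.
  rewrite (_ : _ * _ = ((p i)%:R `^ g * (p i)%:R `^ (- rho) * (p i)%:R `^ alpha) * (c * z)).
    by rewrite pE mul1r.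
  by ring.
apply: (@le_trans _ _ (C%:E * weighted_series eta a x)%E); last first.
  by rewrite leeDr// mule_ge0// lee_fin ltW.
apply: (@le_trans _ _ (C%:E * \sum_(p 0%N <= n < p N) (F n)%:E)%E); last first.
  apply: lee_wpmul2l; first by rewrite lee_fin powR_ge0.
  exact: sum_nat_le_series.
rewrite !sumEFin -EFinM lee_fin -(@sum_block _ _ p N (fun l _ => pS l)) mulr_sumr.
apply: ler_sum => i _; rewrite /D /block_sum !mulr_sumr.
rewrite big_nat_cond [leRHS]big_nat_cond; apply: ler_sum => n /andP[/andP[pn np] _].
rewrite /F mulrA ler_wpM2r ?modulus_ge0// /C.
have n0 : 0 < n%:R :> R by rewrite ltr0n (leq_trans (p0 i)).
have c10 : 0 < 1 + c by rewrite addr_gt0.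
have e0 : 0 <= - eta by lra.
have powN (y : R) : y `^ eta = (y `^ (- eta))^-1 by rewrite powRN invrK.
rewrite (powN (p i)%:R) (powN n%:R) ler_pdivlMr ?powR_gt0// mulrC.
rewrite ler_pdivrMr ?powR_gt0// -powRM ?(ltW c10) ?(ltW (pr0 i))//.
apply: ge0_ler_powR; rewrite ?nnegrE ?(ltW n0) ?mulr_ge0 ?(ltW c10) ?(ltW (pr0 i))//.
(* Since alpha < 1, the length of a block is at most c p_i. *)
have : n%:R <= (p i.+1)%:R :> R by rewrite ler_nat ltnW.
have := gap i.
have : c * (p i)%:R `^ alpha <= c * (p i)%:R.
  rewrite ler_wpM2l ?(ltW c0)// -[leRHS]powRr1 ?(ltW (pr0 i))//.
  by rewrite ler_powR ?ler1n// ltW.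
lra.
Qed.

End Interpolation.

(** * Ritt operators on L^1 *)

Section RittL1.
Context d (X : measurableType d) (R : realType)
  (m : {measure set X -> \bar R}) (k : scalar_kind).
Local Open Scope quotient_scope.
Context (T : {linear L1 m k -> L1 m k}) (hT : ritt T).
Implicit Types (f g : L1 m k) (r s theta : R).

Lemma sum_binom_coef_le1 theta N : 0 < theta -> theta < 1 ->
  \sum_(0 <= j < N) binom_coef theta j.+1 <= 1.
Proof.
move=> t0 t1; under eq_bigr do rewrite binom_coef_tail// -opprB.
by rewrite sumrN telescope_sumr// opprB binom_tail0 gerBl binom_tail_ge0.
Qed.

(** The norms of the terms are at most the coefficients times a constant. *)
Lemma frac_power_cvgn theta f : 0 < theta -> theta < 1 -> cvgn (fun N =>
  \sum_(0 <= j < N) of_real k (binom_coef theta j.+1) *: iter j.+1 T f).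
Proof.
move=> t0 t1; have [C [C0 hC _]] := ritt_rnorm hT.
apply: (@L1_series_cvgn _ _ _ _ _ _ (C * rnorm f)) => N.
apply: (@le_trans _ _ (\sum_(0 <= j < N) binom_coef theta j.+1 * (C * rnorm f))).
  apply: ler_sum => j _; rewrite rnormZ_real ?binom_coef_ge0//.
  by rewrite ler_wpM2l ?binom_coef_ge0.
rewrite -mulr_suml ler_piMl ?sum_binom_coef_le1//.
by rewrite mulr_ge0// rnorm_ge0.
Qed.

Lemma orbit_decays r K f (g : L1 m k) (a : nat -> L1fun m k) :
  0 <= r -> 0 <= K ->
  (forall n, \pi_(L1 m k) (a n) = iter n T g) ->
  (forall n, rnorm (iter n T g) <= K * n.+1%:R `^ (- r) * rnorm f) ->
  (forall n, rnorm (iter n T (g - T g)) <= K * n.+1%:R `^ (- (r + 1)) * rnorm f) ->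
  decays r (K * rnorm f) a.
Proof.
move=> r0 K0 ag hg hdg n.
have mono q : 0 <= q -> n.+2%:R `^ (- q) <= n.+1%:R `^ (- q) :> R.
  move=> q0; rewrite !powRN lef_pV2 ?posrE ?powR_gt0 ?ltr0n//.
  by apply: ge0_ler_powR; rewrite ?nnegrE ?ler_nat.
split.
  rewrite /nu ag (le_trans (hg _))// [leRHS]mulrAC ler_wpM2r ?rnorm_ge0//.
  by rewrite ler_wpM2l// mono.
rewrite /nu piL1B !ag.
rewrite -[_ - _](iter_diffB T n.+1 g).
rewrite (le_trans (hdg _))// [leRHS]mulrAC ler_wpM2r ?rnorm_ge0//.
by rewrite ler_wpM2l// mono// addr_ge0.
Qed.

Lemma real_power_orbit_decays r : 0 < r -> exists2 K, 0 <= K &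
  forall f, decays r (K * rnorm f) (fun n => repr (iter n T (real_power T r f))).
Proof.
move=> r0; have r0' := ltW r0.
have [K0 K00 h0] := real_power_decay 0 hT r0' frac_power_cvgn.
have [K1 K10 h1] := real_power_decay 1 hT r0' frac_power_cvgn.
exists (K0 + K1) => [|f]; first exact: addr_ge0.
apply: (@orbit_decays r _ f (real_power T r f)) => //.
- exact: addr_ge0.
- by move=> n; rewrite reprK.
- move=> n; have := h0 n f; rewrite addr0 => /le_trans; apply.
  by rewrite ler_wpM2r ?rnorm_ge0// ler_wpM2r ?powR_ge0// lerDl.
- move=> n; apply: le_trans (h1 n f) _.
  by rewrite ler_wpM2r ?rnorm_ge0// ler_wpM2r ?powR_ge0// lerDr.
Qed.

Definition orbit_diff f n : L1fun m k := repr (iter n T f) - repr (iter n.+1 T f).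

Lemma orbit_diff_decays : exists2 K, 0 <= K &
  forall f, decays 1 (K * rnorm f) (orbit_diff f).
Proof.
have [C [C0 hC hD]] := ritt_rnorm hT.
have [K1 K10 h1] := iter_diff_decay 1 C0 hC hD.
have [K2 K20 h2] := iter_diff_decay 2 C0 hC hD.
exists (K1 + K2) => [|f]; first exact: addr_ge0.
apply: (@orbit_decays 1 _ f (f - T f)) => //.
- exact: addr_ge0.
- by move=> n; rewrite piL1B !reprK; exact/esym/iter_diffB.
- move=> n; apply: le_trans (h1 n f) _.
  by rewrite ler_wpM2r ?rnorm_ge0// ler_wpM2r ?powR_ge0// lerDl.
- move=> n; apply: le_trans (h2 n f) _.
  by rewrite ler_wpM2r ?rnorm_ge0// ler_wpM2r ?powR_ge0// lerDr.
Qed.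

(** After this, the suprema and the variation and oscillation norms only
    require a pointwise comparison. *)
Lemma real_power_variation_bounded r beta (V : L1 m k -> X -> \bar R) :
  0 < r -> 0 <= beta -> beta < r ->
  (forall f, measurable_fun setT (V f)) -> (forall f x, (0 <= V f x)%E) ->
  (forall f x, (V f x <=
     total_variation beta (fun n => repr (iter n T (real_power T r f))) x)%E) ->
  bounded_in_L1 V.
Proof.
move=> r0 b0 br mV V0 VG; have [K K0 hK] := real_power_orbit_decays r0.
apply: (bounded_in_L1_majorant mV _ V0 VG) => f.
  exact: measurable_total_variation.
apply: le_trans (integral_total_variation (hK f) _ b0 br) _.
  by rewrite mulr_ge0// rnorm_ge0.
by rewrite lee_fin mulrAC.
Qed.

Lemma square_function_bounded r s alpha :
  0 < r -> 1 <= s -> alpha + 1 < s * r ->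
  bounded_in_L1 (fun (f : L1 m k) x =>
    ((\sum_(1 <= n <oo)
        (n%:R `^ alpha * modulus (eval_L1 (iter n T (real_power T r f)) x) `^ s)%:E)
      `^ s^-1)%E).
Proof.
move=> r0 s1 asr; have [K K0 hK] := real_power_orbit_decays r0.
have [g [delta [g0 gr dr hle]]] := root_weighted_series_le m k r0 s1 asr.
pose a f n : L1fun m k := repr (iter n T (real_power T r f)).
apply: (bounded_in_L1_majorant
  (G := fun f x => (total_variation g (a f) x + weighted_series delta (a f) x)%E)).
- move=> f; apply: measurable_root_series => [n|n x]; last first.
    by rewrite lee_fin mulr_ge0 ?powR_ge0.
  apply/measurable_EFinP; apply: measurable_funM; first exact: measurable_cst.
  apply: (measurableT_comp (measurable_powR s)).
  exact: (measurable_L1fun_modulus (a f n)).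
- move=> f; apply: emeasurable_funD; first exact: measurable_total_variation.
  exact: measurable_weighted_series.
- by move=> f x; exact: poweR_ge0.
- by move=> f x; exact: (hle (a f)).
move=> f; have K0f : 0 <= K * rnorm f by rewrite mulr_ge0// rnorm_ge0.
rewrite ge0_integralD//; last 4 first.
- by move=> x _; exact: total_variation_ge0.
- exact: measurable_total_variation.
- by move=> x _; exact: weighted_series_ge0.
- exact: measurable_weighted_series.
apply: le_trans (leeD (integral_total_variation (hK f) K0f g0 gr)
  (integral_weighted_series (hK f) K0f dr)) _.
by rewrite -EFinD lee_fin -mulrDr mulrAC.
Qed.

Lemma block_variation_bounded (p : nat -> nat) (alpha beta c s : R)
    (V : L1 m k -> nat -> X -> \bar R) :
  increasing_positive p -> 0 < alpha -> 0 <= beta -> beta < 1 - alpha ->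
  0 < c -> 1 <= s ->
  (forall i, (p i.+1)%:R - (p i)%:R <= c * (p i)%:R `^ alpha) ->
  (1 - alpha) / (1 - alpha - beta) < s ->
  (forall f i, measurable_fun setT (V f i)) ->
  (forall f i x, (0 <= V f i x)%E) ->
  (forall f i x, (V f i x <=
    ((p i)%:R `^ (beta * s) * block_sum p (orbit_diff f) i x `^ s)%:E)%E) ->
  bounded_in_L1 (fun f x => ((\sum_(0 <= i <oo) V f i x) `^ s^-1)%E).
Proof.
move=> hp al0 b0 bal c0 s1 gap sab mV V0 VD.
have [K K0 hK] := orbit_diff_decays.
have [rho [eta [C [rho0 rho1 eta0 C0 hle]]]] :=
  root_block_sum_le m k hp al0 b0 bal c0 s1 gap sab.
have c0' := ltW c0.
have mTV f : measurable_fun setT (fun x =>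
    (c%:E * total_variation rho (orbit_diff f) x)%E).
  by apply: measurable_funeM; exact: measurable_total_variation.
have mWS f : measurable_fun setT (fun x =>
    (C%:E * weighted_series eta (orbit_diff f) x)%E).
  by apply: measurable_funeM; exact: measurable_weighted_series.
apply: (bounded_in_L1_majorant
  (G := fun f x => (c%:E * total_variation rho (orbit_diff f) x
                    + C%:E * weighted_series eta (orbit_diff f) x)%E)).
- by move=> f; exact: measurable_root_series.
- by move=> f; exact: emeasurable_funD.
- by move=> f x; exact: poweR_ge0.
- by move=> f x; apply: le_trans (hle (orbit_diff f) x); exact: root_series_mono.
move=> f; have K0f : 0 <= K * rnorm f by rewrite mulr_ge0// rnorm_ge0.
rewrite ge0_integralD//; last 2 first.
- by move=> x _; rewrite mule_ge0 ?lee_fin// total_variation_ge0.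
- by move=> x _; rewrite mule_ge0 ?lee_fin// weighted_series_ge0.
rewrite !ge0_integralZl_EFin//; last 4 first.
- by move=> x _; exact: total_variation_ge0.
- exact: measurable_total_variation.
- by move=> x _; exact: weighted_series_ge0.
- exact: measurable_weighted_series.
have eta1 : eta + 1 < 1 by rewrite gtrDr.
have iTV := integral_total_variation (hK f) K0f rho0 rho1.
have iWS := integral_weighted_series (hK f) K0f eta1.
have cC : (0 <= c%:E)%E /\ (0 <= C%:E)%E by rewrite !lee_fin.
apply: le_trans (leeD (lee_wpmul2l cC.1 iTV) (lee_wpmul2l cC.2 iWS)) _.
rewrite -!EFinM -EFinD lee_fin.
rewrite !mulrA ![_ * rnorm f * _]mulrAC -mulrDl.
exact: lexx.
Qed.

End RittL1.

Theorem theorem1p3 (d : measure_display) (X : measurableType d)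
    (R : realType) (m : {sigma_finite_measure set X -> \bar R})
    (k : scalar_kind) (T : {linear L1 m k -> L1 m k}) (r s : R)
    (hT : ritt T) (hr : 0 < r) (hs : 1 <= s) :
  [/\ forall alpha : R, -1 < alpha -> alpha + 1 < s * r ->
        bounded_in_L1 (fun (f : L1 m k) x =>
          ((\sum_(1 <= n <oo)
              (n%:R `^ alpha * modulus (eval_L1 (iter n T (real_power T r f)) x) `^ s)%:E)
            `^ s^-1)%E),
      forall alpha : R, alpha < r ->
        bounded_in_L1 (fun (f : L1 m k) x =>
          ereal_sup [set (n%:R `^ alpha
                          * modulus (eval_L1 (iter n T (real_power T r f)) x))%:E
                    | n in [set n | (1 <= n)%N]]),
      forall beta : R, beta = 0 \/ (0 < beta /\ 1 < s * (r - beta)) ->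
        bounded_in_L1 (fun (f : L1 m k) x =>
          variation_norm s [set n | (1 <= n)%N]
            (fun n => of_real k (n%:R `^ beta)
                      * eval_L1 (iter n T (real_power T r f)) x))
        /\
        forall nk : nat -> nat, increasing_positive nk ->
          bounded_in_L1 (fun (f : L1 m k) x =>
            oscillation_norm s nk
              (fun n => of_real k (n%:R `^ beta)
                        * eval_L1 (iter n T (real_power T r f)) x))
    & forall (nk : nat -> nat) (alpha beta : R),
        increasing_positive nk -> 0 < alpha -> alpha < 1 ->
        gaps_like nk alpha -> 0 <= beta -> beta < 1 - alpha ->
        [/\ (1 - alpha) / (1 - alpha - beta) < s ->
            bounded_in_L1 (fun (f : L1 m k) x =>
              ((\sum_(0 <= i <oo)
                  ((nk i)%:R `^ (beta * s)
                   * modulus (eval_L1 (iter (nk i) T f) x - eval_L1 (iter (nk i.+1) T f) x) `^ s)%:E)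
                `^ s^-1)%E)
            /\
            bounded_in_L1 (fun (f : L1 m k) x =>
              ((\sum_(0 <= i <oo)
                  ((nk i)%:R `^ (beta * s)
                   * (\big[Num.max/0]_(nk i <= n < nk i.+1)
                        modulus (eval_L1 (iter n T f) x - eval_L1 (iter (nk i) T f) x)) `^ s)%:E)
                `^ s^-1)%E)
          & 1 / (1 - alpha - beta) < s ->
            bounded_in_L1 (fun (f : L1 m k) x =>
              ((\sum_(0 <= i <oo)
                  ((nk i)%:R `^ (beta * s))%:E
                  * variation_norm s [set n | (nk i <= n < nk i.+1)%N]
                      (fun n => eval_L1 (iter n T f) x) `^ s)
                `^ s^-1)%E)]].
Proof.
pose a f n : L1fun m k := repr (iter n T (real_power T r f)).
split.
- by move=> alpha _ asr; exact: square_function_bounded.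
- move=> alpha ar; pose beta := Num.max alpha 0.
  apply: (@real_power_variation_bounded _ _ _ _ _ _ hT r beta) => //.
  + by rewrite le_max lexx orbT.
  + by rewrite gt_max ar hr.
  + move=> f; apply: (measurable_sup_ge 1) => n.
    apply/measurable_EFinP; apply: measurable_funM; first exact: measurable_cst.
    exact: (measurable_L1fun_modulus (a f n)).
  + move=> f x; apply: (@le_trans _ _ (1%:R `^ alpha * modulus (a f 1%N x))%:E).
      by rewrite lee_fin mulr_ge0 ?powR_ge0 ?modulus_ge0.
    by apply: ereal_sup_ubound; exists 1%N.
  + move=> f x; apply: ge_ereal_sup => _ [n /= n1 <-].
    apply: le_trans (weigh_le_total_variation beta (a f) x n1).
    rewrite lee_fin ler_wpM2r ?modulus_ge0// ler_powR ?ler1n//.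
    by rewrite le_max lexx.
- move=> beta hb; have [b0 br] : 0 <= beta /\ beta < r.
    case: hb => [->//|[b0 sb]]; split; first exact: ltW.
    rewrite -subr_gt0 -(pmulr_rgt0 _ (lt_le_trans ltr01 hs)).
    exact: lt_trans sb.
  have wS f x i j : (1 <= i)%N -> (\sum_(i <= n < j) (modulus
      (weigh beta (a f) n x - weigh beta (a f) n.+1 x))%:E <=
      total_variation beta (a f) x)%E.
    move=> i1; apply: le_trans (variation_series_le beta (a f) x).
    by apply: sum_nat_le_series => // n; rewrite lee_fin modulus_ge0.
  split=> [|nk hnk];
    apply: (@real_power_variation_bounded _ _ _ _ _ _ hT r beta) => //.
  + by move=> f; exact: (@measurable_variation_norm _ _ _ _ _ _ _ (weigh beta (a f)) 1%N).
  + by move=> f x; exact: (@variation_norm_ge0 _ _ _ _ _ 1%N).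
  + move=> f x; apply: variation_norm_le => // i j /= i1 _ _.
    exact: (wS f x).
  + by move=> f; exact: (measurable_oscillation_norm s nk (weigh beta (a f))).
  + by move=> f x; exact: poweR_ge0.
  + move=> f x; apply: oscillation_norm_le => //.
    exact: (variation_series_le beta (a f) x).
move=> nk alpha beta hnk al0 al1 [c1 [c2 [_ c20 gap]]] b0 bal.
have gap2 i : (nk i.+1)%:R - (nk i)%:R <= c2 * (nk i)%:R `^ alpha.
  by have /andP[] := gap i.
have [_ nkS] := hnk.
have s0 : 0 <= s by rewrite (le_trans ler01).
have block_le f i x (v : R) : 0 <= v -> v <= block_sum nk (orbit_diff T f) i x ->
    ((nk i)%:R `^ (beta * s) * v `^ s <=
     (nk i)%:R `^ (beta * s) * block_sum nk (orbit_diff T f) i x `^ s)%R.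
  move=> v0 vD; rewrite ler_wpM2l ?powR_ge0// ge0_ler_powR// ?nnegrE//.
  exact: block_sum_ge0.
split=> [sab|sab].
  split; apply: (block_variation_bounded hT hnk al0 b0 bal c20 hs gap2 sab).
  + move=> f i; apply/measurable_EFinP.
    apply: measurable_funM; first exact: measurable_cst.
    apply: (measurableT_comp (measurable_powR s)).
    exact: (measurable_L1fun_modulus (repr (iter (nk i) T f) - repr (iter (nk i.+1) T f))).
  + by move=> f i x; rewrite lee_fin mulr_ge0 ?powR_ge0.
  + move=> f i x; rewrite lee_fin block_le ?modulus_ge0//.
    exact: (modulus_sub_le_sum (fun n => eval_L1 (iter n T f) x) (ltnW (nkS i))).
  + move=> f i; apply/measurable_EFinP.
    apply: measurable_funM; first exact: measurable_cst.
    apply: (measurableT_comp (measurable_powR s)); apply: measurable_bigmax => n.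
    exact: (measurable_L1fun_modulus (repr (iter n T f) - repr (iter (nk i) T f))).
  + by move=> f i x; rewrite lee_fin mulr_ge0 ?powR_ge0.
  + move=> f i x; rewrite lee_fin block_le ?bigmax_ge0//.
    apply: (bigmax_modulus_le (fun n => eval_L1 (iter n T f) x)) => n /andP[_].
    exact: ltnW.
have sab' : (1 - alpha) / (1 - alpha - beta) < s.
  apply: le_lt_trans sab; rewrite ler_pM2r ?invr_gt0; lra.
apply: (block_variation_bounded hT hnk al0 b0 bal c20 hs gap2 sab').
- move=> f i; apply: measurable_funeM; apply: (measurableT_comp (measurable_poweR s)).
  apply: (@measurable_variation_norm _ _ _ _ _ _ _ (fun n => repr (iter n T f)) (nk i)) => //=.
  by rewrite leqnn nkS.
- by move=> f i x; rewrite mule_ge0 ?poweR_ge0// lee_fin powR_ge0.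
move=> f i x; rewrite EFinM lee_wpmul2l ?lee_fin ?powR_ge0// -poweR_EFin.
have Ji : (nk i <= nk i < nk i.+1)%N by rewrite leqnn nkS.
apply: gt0_ler_poweR => //.
- by rewrite in_itv/= leey andbT; exact: (@variation_norm_ge0 _ _ _ _ _ (nk i)).
- by rewrite in_itv/= leey andbT lee_fin block_sum_ge0.
apply: variation_norm_le => // u v /= /andP[iu _] /andP[_ vi] uv.
rewrite /block_sum -sumEFin.
rewrite [leRHS](big_cat_nat (n := u))//=; last by apply: leq_trans uv (ltnW vi).
rewrite [X in (_ <= _ + X)%E](big_cat_nat (n := v))//=; last exact: ltnW.
rewrite addeCA leeDl// adde_ge0// sume_ge0// => *; rewrite lee_fin; exact: modulus_ge0.
Qed.
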